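(* Let $X=(-\infty,\infty)$ or $X=\mathbb T=[0,1]/\{0,1\}$, let $I=C(X)\otimes K$, let $\mathbf p$ be a projection in $M_m(\mathcal C(I))$ for some $m\ge1$, and let $n\ge 1$. Then the class $[\mathbf p]_0\in K_0(\mathcal C(I))$ is liftable, i.e. lies in the image of $K_0(M(I))\to K_0(\mathcal C(I))$, if and only if $\mathbf p\oplus 1_n\oplus 0_n\in M_{m+2n}(\mathcal C(I))$ is liftable to a projection in $M_{m+2n}(M(I))$.
   Context: $H$ is a separable infinite-dimensional complex Hilbert space, $B(H)$ the bounded operators and $K$ the compact operators on $H$. $I=C(X)\otimes K$ is the $C^*$-algebra of norm continuous functions $X\to K$ (vanishing in norm at the infinite ends of $X$, if any). Its multiplier algebra is $M(I)=C_b(X,B(H))$, the bounded functions $X\to B(H)$ continuous for the double-strong (i.e. strong-$*$) topology. $\mathcal C(I)=M(I)/I$ is the corona algebra; the maps on $K_0$ and on matrix algebras are induced by the quotient map $M(I)\to\mathcal C(I)$. $1_n$ and $0_n$ denote the identity and zero of $M_n(\mathcal C(I))$. *)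

(* Defs.v *)
From HB Require Import structures.
From mathcomp Require Import all_boot all_order all_algebra.
From mathcomp Require Import generic_quotient ring_quotient.
From mathcomp Require Import complex sesquilinear.
From mathcomp Require Import all_classical all_reals all_analysis.
From mathcomp Require Import finmap ring lra.
Import Order.TTheory GRing.Theory Num.Theory.
Import numFieldNormedType.Exports.

Set Implicit Arguments.
Unset Strict Implicit.
Unset Printing Implicit Defensive.

Local Open Scope classical_set_scope.
Local Open Scope ring_scope.
Local Open Scope quotient_scope.

(* K_0 of a unital C*-algebra only depends on its underlying unital *-ring (its
   projections and partial isometries), so it is defined here for *-rings. *)

HB.mixin Record PzRing_hasStar A of GRing.PzRing A := {
  star : A -> A;
  starK : involutive star;
  starD : {morph star : x y / x + y};
  starM : forall x y, star (x * y) = star y * star x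
}.

#[short(type="starRingType")]
HB.structure Definition StarRing := {A of GRing.PzRing A & PzRing_hasStar A}.

Section StarRingTheory.
Variable A : starRingType.

Lemma star0 : star (0 : A) = 0.
Proof. by apply: (addIr (star (0 : A))); rewrite -starD !add0r. Qed.

Lemma starN : {morph @star A : x / - x}.
Proof.
by move=> x; apply: (addIr (star x)); rewrite -starD !addNr star0.
Qed.

Lemma starB : {morph @star A : x y / x - y}.
Proof. by move=> x y; rewrite starD starN. Qed.

Lemma star1 : star (1 : A) = 1.
Proof. by rewrite -[LHS]mul1r -[X in X * _]starK -starM mul1r starK. Qed.

Lemma star_sum I (r : seq I) (P : pred I) (F : I -> A) :
  star (\sum_(i <- r | P i) F i) = \sum_(i <- r | P i) star (F i).
Proof. exact: (big_morph _ starD star0). Qed.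

End StarRingTheory.

HB.mixin Record isStarMorphism (A B : starRingType) (f : A -> B) := {
  star_morph : {morph f : x / star x}
}.

#[short(type="starMorphism")]
HB.structure Definition StarMorphism (A B : starRingType) :=
  {f of @GRing.RMorphism A B f & isStarMorphism A B f}.

(* Left multiplication suffices: closure under star makes the ideal two-sided. *)
HB.mixin Record isStarIdeal (A : starRingType) (I : A -> bool) := {
  star_ideal_mull : forall a, {in I, forall x, a * x \in I};
  star_ideal_star : {in I, forall x, star x \in I}
}.

#[short(type="starIdeal")]
HB.structure Definition StarIdeal (A : starRingType) :=
  {I of GRing.ZmodClosed A I & isStarIdeal A I}.

Definition star_quot (A : starRingType) (I : starIdeal A) : Type :=
  Quotient.quot I.

Section StarQuotient.
Variables (A : starRingType) (I : starIdeal A).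
Local Notation Q := (star_quot I).

HB.instance Definition _ := Choice.on Q.
HB.instance Definition _ := EqQuotient.copy Q (Quotient.quot I).
HB.instance Definition _ := GRing.Zmodule.copy Q (Quotient.quot I).

Lemma star_idealMl (a x : A) : x \in I -> a * x \in I.
Proof. exact: star_ideal_mull. Qed.

Lemma star_idealS (x : A) : x \in I -> star x \in I.
Proof. exact: star_ideal_star. Qed.

Lemma star_quotE (x y : A) : (\pi_Q x = \pi_Q y) <-> (x - y \in I).
Proof. by rewrite (Quotient.idealrBE I); split=> /eqP. Qed.

Lemma star_quot_repr (x : A) : x - repr (\pi_Q x) \in I.
Proof. by apply/star_quotE; rewrite reprK. Qed.

Lemma star_idealMr a x : x \in I -> x * a \in I.
Proof.
move=> Ix; rewrite -[_ * _]starK starM; apply: star_idealS.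
exact/star_idealMl/star_idealS.
Qed.

Definition star_quot_one : Q := \pi_Q 1.
Definition star_quot_mul (x y : Q) : Q := \pi_Q (repr x * repr y).
Definition star_quot_star (x : Q) : Q := \pi_Q (star (repr x)).

Lemma star_quot_piM : {morph \pi_Q : x y / x * y >-> star_quot_mul x y}.
Proof.
move=> x y; apply/star_quotE.
rewrite -[_ * _](subrK (repr (\pi_Q x) * y)) -mulrBl -addrA -mulrBr.
apply: rpredD; first exact/star_idealMr/star_quot_repr.
exact/star_idealMl/star_quot_repr.
Qed.

Lemma star_quot_piS : {morph \pi_Q : x / star x >-> star_quot_star x}.
Proof.
by move=> x; apply/star_quotE; rewrite -starB; exact/star_idealS/star_quot_repr.
Qed.

Lemma star_quot_piD : {morph \pi_Q : x y / x + y >-> x + y}.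
Proof. exact: (Quotient.pi_add I). Qed.

Lemma star_quot_pi0 : \pi_Q 0 = 0.
Proof. by rewrite -[0 in RHS]/(Quotient.zero I) /Quotient.zero; unlock. Qed.

Fact star_quot_mulA : associative star_quot_mul.
Proof.
move=> x y z; rewrite -[x](@reprK _ Q) -[y](@reprK _ Q) -[z](@reprK _ Q).
by rewrite -!star_quot_piM mulrA.
Qed.
Fact star_quot_mul1 : left_id star_quot_one star_quot_mul.
Proof. by move=> x; rewrite -[x](@reprK _ Q) -star_quot_piM mul1r. Qed.
Fact star_quot_mulr1 : right_id star_quot_one star_quot_mul.
Proof. by move=> x; rewrite -[x](@reprK _ Q) -star_quot_piM mulr1. Qed.
Fact star_quot_mulDl : left_distributive star_quot_mul +%R.
Proof.
move=> x y z; rewrite -[x](@reprK _ Q) -[y](@reprK _ Q) -[z](@reprK _ Q).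
by rewrite -star_quot_piD -!star_quot_piM -star_quot_piD mulrDl.
Qed.
Fact star_quot_mulDr : right_distributive star_quot_mul +%R.
Proof.
move=> x y z; rewrite -[x](@reprK _ Q) -[y](@reprK _ Q) -[z](@reprK _ Q).
by rewrite -star_quot_piD -!star_quot_piM -star_quot_piD mulrDr.
Qed.

HB.instance Definition _ := GRing.Zmodule_isPzRing.Build Q
  star_quot_mulA star_quot_mul1 star_quot_mulr1 star_quot_mulDl star_quot_mulDr.

Fact star_quot_starK : involutive star_quot_star.
Proof. by move=> x; rewrite -[x](@reprK _ Q) -!star_quot_piS starK. Qed.
Fact star_quot_starD : {morph star_quot_star : x y / x + y}.
Proof.
move=> x y; rewrite -[x](@reprK _ Q) -[y](@reprK _ Q).
by rewrite -star_quot_piD -!star_quot_piS starD star_quot_piD.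
Qed.
Fact star_quot_starM (x y : Q) :
  star_quot_star (x * y) = star_quot_star y * star_quot_star x.
Proof.
rewrite -[x](@reprK _ Q) -[y](@reprK _ Q) -[LHS]/(star_quot_star (star_quot_mul _ _)).
by rewrite -star_quot_piM -!star_quot_piS starM star_quot_piM.
Qed.

HB.instance Definition _ := PzRing_hasStar.Build Q
  star_quot_starK star_quot_starD star_quot_starM.

Definition star_quot_pi (x : A) : Q := \pi_Q x.

Fact star_quot_pi_zmod : zmod_morphism star_quot_pi.
Proof.
move=> x y; rewrite /star_quot_pi star_quot_piD; congr (_ + _).
exact: (Quotient.pi_opp I).
Qed.
Fact star_quot_pi_monoid : monoid_morphism star_quot_pi.
Proof. by split=> // x y; exact: star_quot_piM. Qed.
HB.instance Definition _ :=
  GRing.isZmodMorphism.Build A Q star_quot_pi star_quot_pi_zmod.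
HB.instance Definition _ :=
  GRing.isMonoidMorphism.Build A Q star_quot_pi star_quot_pi_monoid.
HB.instance Definition _ := isStarMorphism.Build A Q star_quot_pi star_quot_piS.

End StarQuotient.

Definition mxstar (A : starRingType) m n (v : 'M[A]_(m, n)) : 'M[A]_(n, m) :=
  map_mx star v^T.

Definition is_proj (A : starRingType) n (p : 'M[A]_n) : Prop :=
  mxstar p = p /\ p *m p = p.

(* Murray-von Neumann equivalence of projections in matrix algebras of possibly
   different sizes. *)
Definition mvn (A : starRingType) m n (p : 'M[A]_m) (q : 'M[A]_n) : Prop :=
  exists v : 'M[A]_(n, m), mxstar v *m v = p /\ v *m mxstar v = q.

Section Projections.
Variable A : starRingType.

Lemma mxstarK m n : cancel (@mxstar A m n) (@mxstar A n m).
Proof. by move=> v; apply/matrixP => i j; rewrite !mxE starK. Qed.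

Lemma mxstar0 m n : mxstar (0 : 'M[A]_(m, n)) = 0.
Proof. by apply/matrixP => i j; rewrite !mxE star0. Qed.

Lemma mxstarM m n k (v : 'M[A]_(m, n)) (w : 'M[A]_(n, k)) :
  mxstar (v *m w) = mxstar w *m mxstar v.
Proof.
apply/matrixP => i j; rewrite !mxE star_sum; apply: eq_bigr => l _.
by rewrite !mxE starM.
Qed.

Lemma mxstar_block m1 m2 n1 n2 (a : 'M[A]_(m1, n1)) (b : 'M[A]_(m1, n2))
    (c : 'M[A]_(m2, n1)) (d : 'M[A]_(m2, n2)) :
  mxstar (block_mx a b c d) =
  block_mx (mxstar a) (mxstar c) (mxstar b) (mxstar d).
Proof. by rewrite /mxstar tr_block_mx map_block_mx. Qed.

Lemma is_proj0 n : is_proj (0 : 'M[A]_n).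
Proof. by split; rewrite ?mxstar0 ?mul0mx. Qed.

Lemma is_proj_block m n (p : 'M[A]_m) (q : 'M[A]_n) :
  is_proj p -> is_proj q -> is_proj (block_mx p 0 0 q).
Proof.
move=> [ps pp] [qs qq]; split; first by rewrite mxstar_block ps qs !mxstar0.
by rewrite mulmx_block !(mul0mx, mulmx0) pp qq !(addr0, add0r).
Qed.

Lemma mvn_refl n (p : 'M[A]_n) : is_proj p -> mvn p p.
Proof. by move=> [ps pp]; exists p; rewrite ps. Qed.

Lemma mvn_sym m n (p : 'M[A]_m) (q : 'M[A]_n) : mvn p q -> mvn q p.
Proof. by move=> [v [<- <-]]; exists (mxstar v); rewrite mxstarK. Qed.

Lemma mvn_trans m n k (p : 'M[A]_m) (q : 'M[A]_n) (r : 'M[A]_k) :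
  is_proj p -> is_proj r -> mvn p q -> mvn q r -> mvn p r.
Proof.
move=> [_ pp] [_ rr] [v [vp vq]] [w [wq wr]]; exists (w *m v); rewrite mxstarM.
split.
  by rewrite mulmxA -(mulmxA _ _ w) wq -vq mulmxA vp -mulmxA vp.
by rewrite mulmxA -(mulmxA w) vq -wq mulmxA wr -mulmxA wr.
Qed.

Lemma mvn_block m n m' n' (p : 'M[A]_m) (q : 'M[A]_n)
    (p' : 'M[A]_m') (q' : 'M[A]_n') :
  mvn p p' -> mvn q q' -> mvn (block_mx p 0 0 q) (block_mx p' 0 0 q').
Proof.
move=> [v [vp vp']] [w [wq wq']]; exists (block_mx v 0 0 w).
rewrite mxstar_block !mxstar0 !mulmx_block !(mul0mx, mulmx0).
by rewrite !(addr0, add0r) vp vp' wq wq'.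
Qed.

Lemma mvn_blockC m n (p : 'M[A]_m) (q : 'M[A]_n) : is_proj p -> is_proj q ->
  mvn (block_mx p 0 0 q) (block_mx q 0 0 p).
Proof.
move=> [ps pp] [qs qq]; exists (block_mx 0 q p 0).
rewrite mxstar_block !mxstar0 ps qs !mulmx_block !(mul0mx, mulmx0).
by rewrite pp qq !(addr0, add0r).
Qed.

Lemma mvn_cast m m' (e : m = m') (p : 'M[A]_m) : is_proj p ->
  mvn p (castmx (e, e) p).
Proof. by case: m' / e => hp; rewrite castmx_id; exact: mvn_refl. Qed.

Lemma mvn_blockA m n k (p : 'M[A]_m) (q : 'M[A]_n) (r : 'M[A]_k) :
  is_proj p -> is_proj q -> is_proj r ->
  mvn (block_mx p 0 0 (block_mx q 0 0 r)) (block_mx (block_mx p 0 0 q) 0 0 r).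
Proof.
move=> hp hq hr.
apply: mvn_sym.
have := mvn_cast (esym (addnA m n k)) (is_proj_block (is_proj_block hp hq) hr).
have /= := @block_mxA A m n k m n k p 0 0 0 q 0 0 0 r.
by rewrite !row_mx0 !col_mx0 => <-.
Qed.

Lemma mvn_block0 n (p : 'M[A]_n) : is_proj p ->
  mvn (block_mx (0 : 'M[A]_0) 0 0 p) p.
Proof.
move=> [ps pp]; exists (row_mx 0 p).
have -> : mxstar (row_mx (0 : 'M[A]_(n, 0)) p) = col_mx 0 p.
  by rewrite /mxstar tr_row_mx map_col_mx -/(mxstar p) ps -/(mxstar _) mxstar0.
by rewrite mul_col_row mul_row_col !(mul0mx, mulmx0) pp add0r.
Qed.

End Projections.

Lemma mxstar_map (A B : starRingType) (f : starMorphism A B) m n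
    (v : 'M[A]_(m, n)) : mxstar (map_mx f v) = map_mx f (mxstar v).
Proof. by apply/matrixP => i j; rewrite !mxE star_morph. Qed.

Lemma is_proj_map (A B : starRingType) (f : starMorphism A B) n (p : 'M[A]_n) :
  is_proj p -> is_proj (map_mx f p).
Proof. by move=> [ps pp]; split; rewrite ?mxstar_map -?map_mxM ?ps ?pp. Qed.

Lemma mvn_map (A B : starRingType) (f : starMorphism A B) m n
    (p : 'M[A]_m) (q : 'M[A]_n) :
  mvn p q -> mvn (map_mx f p) (map_mx f q).
Proof.
by move=> [v [vp vq]]; exists (map_mx f v); rewrite mxstar_map -!map_mxM vp vq.
Qed.

Record proj_mx (A : starRingType) := ProjMx {
  proj_size : nat;
  proj_val : 'M[A]_proj_size;
  projP : is_proj proj_val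
}.

HB.instance Definition _ (A : starRingType) := gen_eqMixin (proj_mx A).
HB.instance Definition _ (A : starRingType) := gen_choiceMixin (proj_mx A).

Section MurrayVonNeumann.
Variable A : starRingType.

Definition mvn_rel (p q : proj_mx A) : bool :=
  `[< mvn (proj_val p) (proj_val q) >].

Fact mvn_rel_refl : reflexive mvn_rel.
Proof. by move=> p; apply/asboolP/mvn_refl/projP. Qed.
Fact mvn_rel_sym : symmetric mvn_rel.
Proof. by move=> p q; apply/asboolP/asboolP; exact: mvn_sym. Qed.
Fact mvn_rel_trans : transitive mvn_rel.
Proof.
move=> q p r /asboolP pq /asboolP qr; apply/asboolP.
by apply: mvn_trans pq qr; exact: projP.
Qed.

Canonical mvn_equiv := EquivRel mvn_rel mvn_rel_refl mvn_rel_sym mvn_rel_trans.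

Definition V0 : Type := {eq_quot mvn_rel}.

HB.instance Definition _ := Choice.on V0.
HB.instance Definition _ := EqQuotient.copy V0 {eq_quot mvn_rel}.

Definition V0_class n (p : 'M[A]_n) (hp : is_proj p) : V0 :=
  \pi_V0 (ProjMx hp).

Lemma V0_classP m n (p : 'M[A]_m) (q : 'M[A]_n) hp hq :
  @V0_class m p hp = @V0_class n q hq <-> mvn p q.
Proof. by split=> [/eqmodP/asboolP//|/asboolP h]; exact/eqmodP. Qed.

Lemma V0_ind (P : V0 -> Prop) :
  (forall n (p : 'M[A]_n) (hp : is_proj p), P (V0_class hp)) -> forall x, P x.
Proof.
by move=> h x; rewrite -[x](@reprK _ V0); case: (repr x) => n p hp; exact: h.
Qed.

Definition V0_add (x y : V0) : V0 :=
  V0_class (is_proj_block (projP (repr x)) (projP (repr y))).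

Lemma mvn_repr n (p : 'M[A]_n) (hp : is_proj p) :
  mvn (proj_val (repr (V0_class hp))) p.
Proof.
apply/(V0_classP (projP _) hp); rewrite -[RHS](@reprK _ V0) /V0_class.
by case: (repr _).
Qed.

Lemma V0_addE m n (p : 'M[A]_m) (q : 'M[A]_n) (hp : is_proj p) (hq : is_proj q) :
  V0_add (V0_class hp) (V0_class hq) = V0_class (is_proj_block hp hq).
Proof. by apply/V0_classP/mvn_block; exact: mvn_repr. Qed.

Fact V0_addA : associative V0_add.
Proof.
elim/V0_ind => m p hp; elim/V0_ind => n q hq; elim/V0_ind => k r hr.
by rewrite !V0_addE; exact/V0_classP/mvn_blockA.
Qed.
Fact V0_addC : commutative V0_add.
Proof.
elim/V0_ind => m p hp; elim/V0_ind => n q hq.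
by rewrite !V0_addE; exact/V0_classP/mvn_blockC.
Qed.
Fact V0_add0 : left_id (V0_class (is_proj0 A 0)) V0_add.
Proof. by elim/V0_ind => m p hp; rewrite V0_addE; exact/V0_classP/mvn_block0. Qed.

HB.instance Definition _ := GRing.isNmodule.Build V0 V0_addA V0_addC V0_add0.

Lemma V0_addDE m n (p : 'M[A]_m) (q : 'M[A]_n) (hp : is_proj p) (hq : is_proj q) :
  V0_class hp + V0_class hq = V0_class (is_proj_block hp hq).
Proof. exact: V0_addE. Qed.

End MurrayVonNeumann.

Section V0Map.
Variables (A B : starRingType) (f : starMorphism A B).

Definition V0_map (x : V0 A) : V0 B :=
  V0_class (is_proj_map f (projP (repr x))).

Lemma V0_mapE n (p : 'M[A]_n) (hp : is_proj p) :
  V0_map (V0_class hp) = V0_class (is_proj_map f hp).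
Proof. by apply/V0_classP/mvn_map/mvn_repr. Qed.

Fact V0_map_additive : nmod_morphism V0_map.
Proof.
split=> [|x y].
  by rewrite V0_mapE; apply/V0_classP; rewrite map_mx0; exact/mvn_refl/is_proj0.
elim/V0_ind: x => m p hp; elim/V0_ind: y => n q hq.
rewrite V0_addDE !V0_mapE V0_addDE; apply/V0_classP.
rewrite map_block_mx !map_mx0; apply: mvn_refl.
by apply: is_proj_block; exact: is_proj_map.
Qed.

HB.instance Definition _ :=
  GRing.isNmodMorphism.Build (V0 A) (V0 B) V0_map V0_map_additive.

End V0Map.

Section Grothendieck.
Variable M : nmodType.

Definition groth_rel (x y : M * M) : bool :=
  `[< exists c, x.1 + y.2 + c = y.1 + x.2 + c >].

Fact groth_rel_refl : reflexive groth_rel.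
Proof. by move=> x; apply/asboolP; exists 0. Qed.
Fact groth_rel_sym : symmetric groth_rel.
Proof. by move=> x y; apply/asboolP/asboolP => -[c h]; exists c. Qed.
Fact groth_rel_trans : transitive groth_rel.
Proof.
move=> y x z /asboolP[c h] /asboolP[d k]; apply/asboolP.
exists (y.1 + y.2 + c + d).
have -> : x.1 + z.2 + (y.1 + y.2 + c + d) = (x.1 + y.2 + c) + (y.1 + z.2 + d).
  by rewrite !addrA [LHS](ACl (1*4*5*3*2*6))/=.
by rewrite h k !addrA [LHS](ACl (4*2*1*5*3*6))/=.
Qed.

Canonical groth_equiv :=
  EquivRel groth_rel groth_rel_refl groth_rel_sym groth_rel_trans.

Definition groth : Type := {eq_quot groth_rel}.

HB.instance Definition _ := Choice.on groth.
HB.instance Definition _ := EqQuotient.copy groth {eq_quot groth_rel}.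

Definition groth_sub (x y : M) : groth := \pi_groth (x, y).

Lemma groth_subP (x y x' y' : M) :
  groth_sub x y = groth_sub x' y' <-> exists c, x + y' + c = x' + y + c.
Proof. by split=> [/eqmodP/asboolP//|/asboolP h]; exact/eqmodP. Qed.

Lemma groth_ind (P : groth -> Prop) :
  (forall x y, P (groth_sub x y)) -> forall z, P z.
Proof. by move=> h z; rewrite -[z](@reprK _ groth); case: (repr z). Qed.

Definition groth_add (x y : groth) : groth :=
  groth_sub ((repr x).1 + (repr y).1) ((repr x).2 + (repr y).2).
Definition groth_opp (x : groth) : groth := groth_sub (repr x).2 (repr x).1.

Lemma groth_repr x y : exists c,
  (repr (groth_sub x y)).1 + y + c = x + (repr (groth_sub x y)).2 + c.
Proof.
apply/groth_subP; rewrite -[RHS](@reprK _ groth) /groth_sub.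
by case: (repr _).
Qed.

Lemma groth_addE x y x' y' :
  groth_add (groth_sub x y) (groth_sub x' y') = groth_sub (x + x') (y + y').
Proof.
rewrite /groth_add; apply/groth_subP.
have [c] := groth_repr x y; have [d] := groth_repr x' y'.
move: (repr (groth_sub x y)) (repr (groth_sub x' y')).
move=> [a b] [a' b'] /= k h; exists (c + d).
have -> : a + a' + (y + y') + (c + d) = (a + y + c) + (a' + y' + d).
  by rewrite !addrA [LHS](ACl (1*3*5*2*4*6))/=.
by rewrite h k !addrA [LHS](ACl (1*4*2*5*3*6))/=.
Qed.

Lemma groth_oppE x y : groth_opp (groth_sub x y) = groth_sub y x.
Proof.
apply/groth_subP; have [c h] := groth_repr x y; exists c.
by rewrite [_ + x]addrC -h [_ + y]addrC.
Qed.

Fact groth_addA : associative groth_add.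
Proof.
by elim/groth_ind => ? ?; elim/groth_ind => ? ?; elim/groth_ind => ? ?;
  rewrite !groth_addE !addrA.
Qed.
Fact groth_addC : commutative groth_add.
Proof.
elim/groth_ind => a b; elim/groth_ind => c d.
by rewrite !groth_addE addrC [b + d]addrC.
Qed.
Fact groth_add0 : left_id (groth_sub 0 0) groth_add.
Proof. by elim/groth_ind => a b; rewrite groth_addE !add0r. Qed.
Fact groth_addN : left_inverse (groth_sub 0 0) groth_opp groth_add.
Proof.
elim/groth_ind => a b; rewrite groth_oppE groth_addE.
by apply/groth_subP; exists 0; rewrite !addr0 add0r addrC.
Qed.

HB.instance Definition _ := GRing.isZmodule.Build groth
  groth_addA groth_addC groth_add0 groth_addN.

Lemma groth_subDE x y x' y' :
  groth_sub x y + groth_sub x' y' = groth_sub (x + x') (y + y').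
Proof. exact: groth_addE. Qed.

Lemma groth_subNE x y : - groth_sub x y = groth_sub y x.
Proof. exact: groth_oppE. Qed.

End Grothendieck.

Section GrothendieckMap.
Variables (M N : nmodType) (f : {additive M -> N}).

Definition groth_map (x : groth M) : groth N :=
  groth_sub (f (repr x).1) (f (repr x).2).

Lemma groth_mapE x y : groth_map (groth_sub x y) = groth_sub (f x) (f y).
Proof.
apply/groth_subP; have [c h] := groth_repr x y; exists (f c).
by rewrite -!raddfD h.
Qed.

Fact groth_map_additive : zmod_morphism groth_map.
Proof.
elim/groth_ind => a b; elim/groth_ind => c d.
by rewrite groth_subNE groth_subDE !groth_mapE groth_subNE groth_subDE !raddfD.
Qed.

HB.instance Definition _ :=
  GRing.isZmodMorphism.Build (groth M) (groth N) groth_map groth_map_additive.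

End GrothendieckMap.

(* The unital picture: V0 A is the commutative monoid of Murray-von Neumann
   classes of projections in matrices over A, and K0 A is its Grothendieck group. *)
Definition K0 (A : starRingType) : zmodType := groth (V0 A).

Definition K0_map (A B : starRingType) (f : starMorphism A B) :
  {additive K0 A -> K0 B} := groth_map (V0_map f).

Definition K0_class (A : starRingType) n (p : 'M[A]_n) (hp : is_proj p) : K0 A :=
  groth_sub (V0_class hp) 0.

Lemma K0_mapE (A B : starRingType) (f : starMorphism A B) n (p : 'M[A]_n)
    (hp : is_proj p) : K0_map f (K0_class hp) = K0_class (is_proj_map f hp).
Proof.
have -> : K0_map f (K0_class hp) =
    groth_sub (V0_map f (V0_class hp)) (V0_map f 0) by exact: groth_mapE.
by rewrite V0_mapE raddf0.
Qed.

Local Open Scope complex_scope.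

(* The norm of a normedModType over R[i] takes its values in R[i]; the inner
   product is linear in its first argument. *)
HB.mixin Record isHilbert (R : realType) H of CompleteNormedModule R[i] H := {
  hdot : {dot H for @Num.conj R[i]};
  hdotE : forall x : H, `|x| ^+ 2 = hdot x x
}.

#[short(type="hilbertType")]
HB.structure Definition Hilbert (R : realType) :=
  {H of CompleteNormedModule R[i] H & isHilbert R H}.

Section HilbertTheory.
Variables (R : realType) (H : hilbertType R).
Implicit Types (u v w : H) (a : R[i]).

(* The norm as an element of R (it is real as an element of R[i], see vnormE). *)
Definition vnorm v : R := complex.Re `|v|.

Lemma ger0_ReK (z : R[i]) : 0 <= z -> z = (complex.Re z)%:C.
Proof. by case: z => a b; rewrite lecE /= => /andP[/eqP -> _]. Qed.

Lemma vnormE v : `|v| = (vnorm v)%:C.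
Proof.
exact/ger0_ReK/normr_ge0.
Qed.

Lemma vnorm_ge0 v : 0 <= vnorm v.
Proof. by rewrite -lecR -vnormE normr_ge0. Qed.

Lemma vnormD u v : vnorm (u + v) <= vnorm u + vnorm v.
Proof. by rewrite -lecR rmorphD /= -!vnormE ler_normD. Qed.

Lemma vnormN v : vnorm (- v) = vnorm v.
Proof. by rewrite /vnorm normrN. Qed.

Lemma vnormB u v : vnorm (u - v) = vnorm (v - u).
Proof. by rewrite -vnormN opprB. Qed.

Lemma vnormZ (c : R) v : 0 <= c -> vnorm (c%:C *: v) = c * vnorm v.
Proof.
move=> c0; apply: complexI.
by rewrite -vnormE normrZ rmorphM /= vnormE ger0_norm ?ler0c.
Qed.

Lemma vnorm0 : vnorm (0 : H) = 0.
Proof. by rewrite /vnorm normr0. Qed.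

Lemma vnorm_eq0 v : vnorm v = 0 -> v = 0.
Proof. by move=> v0; apply/eqP; rewrite -normr_eq0 vnormE v0. Qed.

Lemma hdot_vnorm v : hdot v v = (vnorm v ^+ 2)%:C.
Proof. by rewrite -hdotE vnormE rmorphXn. Qed.

Lemma hdotC u v : hdot u v = conjc (hdot v u).
Proof.
rewrite (hermC hdot) expr0 mul1r.
done.
Qed.

Lemma hdotDl u v w : hdot (u + v) w = hdot u w + hdot v w.
Proof. exact: linearDl. Qed.
Lemma hdotDr u v w : hdot w (u + v) = hdot w u + hdot w v.
Proof. exact: linearDr. Qed.
Lemma hdotZl a u v : hdot (a *: u) v = a * hdot u v.
Proof. exact: linearZl_LR. Qed.
Lemma hdotZr a u v : hdot u (a *: v) = conjc a * hdot u v.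
Proof. exact: linearZr_LR. Qed.
Lemma hdotNl u v : hdot (- u) v = - hdot u v.
Proof. exact: linearNl. Qed.
Lemma hdotNr u v : hdot u (- v) = - hdot u v.
Proof. exact: linearNr. Qed.

Lemma vnormD2 u v :
  vnorm (u + v) ^+ 2 = vnorm u ^+ 2 + vnorm v ^+ 2 + 2 * complex.Re (hdot u v).
Proof.
apply: complexI; rewrite -hdot_vnorm hdotDl !hdotDr !hdot_vnorm (hdotC v u).
rewrite 2!rmorphD (rmorphM _ 2) rmorph_nat -addcJ.
by rewrite !addrA [LHS](ACl (1*4*2*3))/=.
Qed.

Lemma hdotr_eq w w' : (forall v, hdot v w = hdot v w') -> w = w'.
Proof.
move=> h; apply/eqP; rewrite -subr_eq0; apply/eqP/vnorm_eq0/eqP.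
rewrite -sqrf_eq0; apply/eqP/complexI.
by rewrite -hdot_vnorm hdotDr hdotNr h subrr.
Qed.

Lemma cauchy_schwarz_re u v : complex.Re (hdot u v) <= vnorm u * vnorm v.
Proof.
have [v0|v0] := eqVneq (vnorm v) 0.
  by rewrite (vnorm_eq0 v0) (linear0r hdot) /= vnorm0 mulr0.
have [u0|u0] := eqVneq (vnorm u) 0.
  by rewrite (vnorm_eq0 u0) (linear0l hdot) /= vnorm0 mul0r.
have v1 : 0 < vnorm v by rewrite lt_neqAle eq_sym v0 vnorm_ge0.
have u1 : 0 < vnorm u by rewrite lt_neqAle eq_sym u0 vnorm_ge0.
have := sqr_ge0 (vnorm ((vnorm v)%:C *: u - (vnorm u)%:C *: v)).
rewrite vnormD2 vnormN !vnormZ ?vnorm_ge0// hdotNr hdotZl hdotZr conjc_real.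
rewrite mulrA -rmorphM /=.
have -> (c : R) (z : R[i]) : complex.Re (- (c%:C * z)) = - (c * complex.Re z).
  by case: z => x y /=; rewrite mul0r subr0.
have -> (a b r : R) : (a * b) ^+ 2 + (b * a) ^+ 2 + 2 * - (a * b * r) =
    2 * (a * b) * (b * a - r) by ring.
by rewrite pmulr_rge0 ?subr_ge0// !mulr_gt0.
Qed.

Lemma cauchy_schwarz u v : `|hdot u v| <= (vnorm u * vnorm v)%:C.
Proof.
have [h0|h0] := eqVneq (hdot u v) 0.
  by rewrite h0 normr0 ler0c mulr_ge0 ?vnorm_ge0.
pose c := conjc (hdot u v) / `|hdot u v|.
have nh : `|hdot u v| != 0 by rewrite normr_eq0.
have nc : `|c| = 1 by rewrite normf_div normr_id normcJ divff.
have -> : `|hdot u v| = (complex.Re (hdot (c *: u) v))%:C.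
  rewrite hdotZl /c mulrAC [conjc _ * _]mulrC -sqr_normc expr2 mulfK//.
rewrite lecR (le_trans (cauchy_schwarz_re _ _))//.
by rewrite /vnorm normrZ nc mul1r.
Qed.

Section convergence.
Context (F : set_system H) {FF : ProperFilter F}.

Lemma vcvgP w : F --> w <->
  forall e : R, 0 < e -> \forall v \near F, vnorm (w - v) < e.
Proof.
split=> [/cvgrPdist_lt h e e0|h].
  have e0' : 0 < e%:C :> R[i] by rewrite ltcR.
  by apply: filterS (h _ e0') => v /=; rewrite vnormE ltcR.
apply/cvgrPdist_lt => e e0.
have eE := ger0_ReK (ltW e0).
have : 0 < complex.Re e by rewrite -ltcR -eE.
by move/h; apply: filterS => v; rewrite vnormE eE ltcR.
Qed.

Lemma vcauchy_cvg :
  (forall e : R, 0 < e ->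
    exists2 A, F A & forall u v, A u -> A v -> vnorm (u - v) < e) ->
  exists w, F --> w.
Proof.
move=> h; exists (lim F); apply: cauchy_cvg; apply: cauchy_exP => e e0.
have eE := ger0_ReK (ltW e0).
have : 0 < complex.Re e by rewrite -ltcR -eE.
move/h => [A FA hA]; have [u Au] := filter_ex FA; exists u.
by apply: filterS FA => v Av; rewrite -ball_normE /ball_/= vnormE eE ltcR; exact: hA.
Qed.
End convergence.
Lemma hdot_ReC u v : complex.Re (hdot u v) = complex.Re (hdot v u).
Proof. by rewrite hdotC; case: (hdot v u). Qed.

Section riesz.
Variables (phi : H -> R[i]) (M : R).
Hypothesis phi_linear : forall a u v, phi (a *: u + v) = a * phi u + phi v.
Hypothesis phi_bounded : forall v, `|phi v| <= (M * vnorm v)%:C.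

Let phi0 : phi 0 = 0.
Proof.
by have := phi_linear 1 0 0; rewrite scale1r mul1r addr0 => /eqP;
  rewrite -subr_eq0 opprD addNKr oppr_eq0 => /eqP.
Qed.

Let f v := complex.Re (phi v).
Let fD u v : f (u + v) = f u + f v.
Proof.
by have := phi_linear 1 u v; rewrite scale1r mul1r /f => ->; case: (phi u) (phi v) => ? ? [].
Qed.
Let fZ (c : R) v : f (c%:C *: v) = c * f v.
Proof.
have := phi_linear c%:C v 0; rewrite !addr0 phi0 addr0 /f => ->.
by case: (phi v) => a b /=; rewrite mul0r subr0.
Qed.
Let f_le v : f v <= M * vnorm v.
Proof.
rewrite -lecR (le_trans _ (phi_bounded v))// (le_trans _ (normc_ge_Re _))//.
by rewrite lecR ler_norm.
Qed.

Let J v := vnorm v ^+ 2 - 2 * f v.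
Let JD u v : J (u + v) = J u + J v + 2 * complex.Re (hdot u v).
Proof. by rewrite /J vnormD2 fD; ring. Qed.
Let JZ (c : R) v : 0 <= c -> J (c%:C *: v) = c ^+ 2 * vnorm v ^+ 2 - 2 * c * f v.
Proof. by move=> c0; rewrite /J vnormZ// fZ; ring. Qed.
Let J_ge v : - M ^+ 2 <= J v.
Proof. by have := f_le v; have := sqr_ge0 (vnorm v - M); rewrite /J; nra. Qed.

Let J_lb : has_inf (range J).
Proof.
split; first by exists (J 0), 0.
by exists (- M ^+ 2) => _ [v _ <-].
Qed.

Let d := inf (range J).
Let J_ged v : d <= J v.
Proof. by apply: ge_inf; [exact: J_lb.2|exists v]. Qed.

Let parallelogram u v :
  vnorm (u - v) ^+ 2 = 2 * J u + 2 * J v - 4 * J (2^-1%:C *: (u + v)).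
Proof.
rewrite JZ ?invr_ge0// vnormD2 vnormD2 vnormN hdotNr fD /J.
have -> : complex.Re (- hdot u v) = - complex.Re (hdot u v) by case: (hdot u v).
by field.
Qed.

Lemma riesz : exists w, forall v, phi v = hdot v w.
Proof.
pose F := filter_from [set e : R | 0 < e] (fun e => [set v | J v < d + e]).
have FF : ProperFilter F.
  apply: filter_from_proper.
    apply: filter_from_filter; first by exists 1 => /=.
    move=> a b /= a0 b0; exists (Num.min a b) => /=; first by rewrite lt_min a0.
    by move=> v /= h; split; apply: (lt_le_trans h); rewrite lerD2l ge_min lexx ?orbT.
  move=> e /= e0; have [_ [v _ <-] h] := inf_adherent e0 J_lb.
  by exists v.
have [|w Fw] := @vcauchy_cvg F FF.
  move=> e e0.
  exists [set v | J v < d + e ^+ 2 / 4].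
    by exists (e ^+ 2 / 4) => //=; rewrite divr_gt0 ?exprn_gt0.
  move=> u v /= hu hv.
  rewrite -(@ltr_pXn2r _ 2)// ?nnegrE ?vnorm_ge0 ?ltW// parallelogram.
  by have := J_ged (2^-1%:C *: (u + v)); lra.
have Jw : J w <= d.
  apply/ler_addgt0Pr => e e0.
  pose K := 2 * vnorm w + 2 * `|M| + 1.
  have K0 : 0 < K by rewrite /K ltr_wpDl// addr_ge0 ?mulr_ge0 ?vnorm_ge0.
  have /vcvgP/(_ (e / 2 / K)) := Fw; rewrite !divr_gt0// => /(_ isT) h1.
  have h2 : F [set v | J v < d + e / 2] by exists (e / 2) => //=; rewrite divr_gt0.
  have [v [/= v1 v2]] := filter_ex (filterI h1 h2).
  have := JD w (v - w); rewrite subrKC.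
  have := f_le (v - w); have := cauchy_schwarz_re w (- (v - w)).
  rewrite vnormN hdotNr.
  have -> : complex.Re (- hdot w (v - w)) = - complex.Re (hdot w (v - w)).
    by case: (hdot w _).
  rewrite {3}/J => h3 h4 h5.
  have : vnorm (v - w) * K < e / 2 by rewrite -ltr_pdivlMr// vnormB.
  have : M * vnorm (v - w) <= `|M| * vnorm (v - w).
    by rewrite ler_wpM2r ?vnorm_ge0 ?ler_norm.
  have := sqr_ge0 (vnorm (v - w)); have := vnorm_ge0 (v - w).
  by rewrite /K; nra.
have key v : f v = complex.Re (hdot w v).
  pose a := complex.Re (hdot w v) - f v; pose b := vnorm v ^+ 2.
  have b0 : 0 <= b by exact: sqr_ge0.
  have tineq (t : R) : 0 <= 2 * t * a + t ^+ 2 * b.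
    have := le_trans Jw (J_ged (w + t%:C *: v)).
    rewrite {2}/J vnormD2 fD fZ hdotZr conjc_real.
    have -> : complex.Re (t%:C * hdot w v) = t * complex.Re (hdot w v).
      by case: (hdot w v) => x y /=; rewrite mul0r subr0.
    have -> : vnorm (t%:C *: v) ^+ 2 = t ^+ 2 * b.
      apply: complexI; rewrite -hdot_vnorm hdotZl hdotZr conjc_real hdot_vnorm.
      by rewrite mulrA -!rmorphM.
    by rewrite /a /J; nra.
  have := tineq (- a / (b + 1)).
  have -> : 2 * (- a / (b + 1)) * a + (- a / (b + 1)) ^+ 2 * b =
      - (a ^+ 2 * ((b + 2) / (b + 1) ^+ 2)).
    by field; rewrite gt_eqF// ltr_wpDl.
  rewrite oppr_ge0 pmulr_lle0; last by rewrite divr_gt0 ?exprn_gt0 ?ltr_wpDl.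
  move=> a2; have /eqP : a ^+ 2 = 0 by apply/eqP; rewrite eq_le a2 sqr_ge0.
  by rewrite sqrf_eq0 subr_eq0 => /eqP ->.
exists w => v; have := key v; have := key ('i%C *: v).
rewrite ![complex.Re (hdot w _)]hdot_ReC hdotZl.
have := phi_linear 'i%C v 0; rewrite !addr0 phi0 addr0 /f => ->.
case: (phi v) (hdot v w) => a b [a' b'] /=.
by rewrite !mul0r !mul1r !sub0r => /oppr_inj -> ->.
Qed.

End riesz.

End HilbertTheory.

#[local] Obligation Tactic := idtac.

Section BoundedOperators.
Variables (R : realType) (H : hilbertType R).

Record bop := Bop {
  bop_fun :> H -> H;
  bop_linear : linear bop_fun;
  bop_bounded : exists M : R, forall v, vnorm (bop_fun v) <= M * vnorm v
}.

Lemma bopP (S T : bop) : (forall v, S v = T v) -> S = T.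
Proof.
case: S T => [f fl fb] [g gl gb] /= /funext fg.
by case: g / fg gl gb => gl gb; congr Bop; exact: Prop_irrelevance.
Qed.

HB.instance Definition _ := gen_eqMixin bop.
HB.instance Definition _ := gen_choiceMixin bop.

HB.instance Definition _ (T : bop) :=
  GRing.isLinear.Build R[i] H H *:%R (bop_fun T) (bop_linear T).

Lemma bop_gt0 (T : bop) :
  exists2 M : R, 0 < M & forall v, vnorm (T v) <= M * vnorm v.
Proof.
have [M hM] := bop_bounded T; exists (`|M| + 1) => [|v].
  by rewrite ltr_wpDl.
rewrite (le_trans (hM v))// ler_wpM2r ?vnorm_ge0//.
by rewrite ler_wpDr// ler_norm.
Qed.

Program Definition bop_zero := @Bop (fun=> 0) _ _.
Next Obligation. by move=> a u v; rewrite scaler0 addr0. Qed.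
Next Obligation. by exists 0 => v; rewrite vnorm0 mul0r. Qed.

Program Definition bop_opp (T : bop) := @Bop (fun v => - T v) _ _.
Next Obligation. by move=> T a u v; rewrite linearP opprD scalerN. Qed.
Next Obligation.
by move=> T; have [M h] := bop_bounded T; exists M => v; rewrite vnormN.
Qed.

Program Definition bop_add (S T : bop) := @Bop (fun v => S v + T v) _ _.
Next Obligation. by move=> S T a u v; rewrite !linearP scalerDr addrACA. Qed.
Next Obligation.
move=> S T; have [M h] := bop_bounded S; have [N k] := bop_bounded T.
exists (M + N) => v; rewrite (le_trans (vnormD _ _))// mulrDl.
by rewrite lerD.
Qed.

Program Definition bop_one := @Bop id _ _.
Next Obligation. by []. Qed.
Next Obligation. by exists 1 => v; rewrite mul1r. Qed.

Program Definition bop_mul (S T : bop) := @Bop (fun v => S (T v)) _ _.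
Next Obligation. by move=> S T a u v; rewrite !linearP. Qed.
Next Obligation.
move=> S T; have [M M0 h] := bop_gt0 S; have [N _ k] := bop_gt0 T.
exists (M * N) => v; rewrite (le_trans (h _))// -mulrA.
by rewrite ler_wpM2l// ltW.
Qed.

Fact bop_addA : associative bop_add.
Proof. by move=> S T U; apply: bopP => v /=; rewrite addrA. Qed.
Fact bop_addC : commutative bop_add.
Proof. by move=> S T; apply: bopP => v /=; rewrite addrC. Qed.
Fact bop_add0 : left_id bop_zero bop_add.
Proof. by move=> S; apply: bopP => v /=; rewrite add0r. Qed.
Fact bop_addN : left_inverse bop_zero bop_opp bop_add.
Proof. by move=> S; apply: bopP => v /=; rewrite addNr. Qed.

HB.instance Definition _ :=
  GRing.isZmodule.Build bop bop_addA bop_addC bop_add0 bop_addN.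

Fact bop_mulA : associative bop_mul.
Proof. by move=> S T U; exact: bopP. Qed.
Fact bop_mul1 : left_id bop_one bop_mul.
Proof. by move=> S; exact: bopP. Qed.
Fact bop_mulr1 : right_id bop_one bop_mul.
Proof. by move=> S; exact: bopP. Qed.
Fact bop_mulDl : left_distributive bop_mul +%R.
Proof. by move=> S T U; exact: bopP. Qed.
Fact bop_mulDr : right_distributive bop_mul +%R.
Proof. by move=> S T U; apply: bopP => v /=; rewrite linearD. Qed.

HB.instance Definition _ := GRing.Zmodule_isPzRing.Build bop
  bop_mulA bop_mul1 bop_mulr1 bop_mulDl bop_mulDr.

Lemma bop0E v : (0 : bop) v = 0. Proof. by []. Qed.
Lemma bopDE (S T : bop) v : (S + T) v = S v + T v. Proof. by []. Qed.
Lemma bopNE (T : bop) v : (- T) v = - T v. Proof. by []. Qed.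
Lemma bopBE (S T : bop) v : (S - T) v = S v - T v. Proof. by []. Qed.
Lemma bopME (S T : bop) v : (S * T) v = S (T v). Proof. by []. Qed.

Lemma bop_adjoint (T : bop) :
  exists S : bop, forall u v, hdot (T u) v = hdot u (S v).
Proof.
have [M M0 hM] := bop_gt0 T.
have /choice[S hS] v : exists w, forall u, hdot (T u) v = hdot u w.
  apply: (@riesz _ _ (fun u => hdot (T u) v) (M * vnorm v)).
    by move=> a x y; rewrite linearP hdotDl hdotZl.
  move=> u; rewrite (le_trans (cauchy_schwarz _ _))// lecR mulrAC.
  by rewrite ler_wpM2r ?vnorm_ge0.
have Sl : linear S.
  move=> a u v; apply: hdotr_eq => w.
  by rewrite -hS !hdotDr !hdotZr -!hS.
suff Sb : exists N : R, forall v, vnorm (S v) <= N * vnorm v by exists (Bop Sl Sb).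
exists M => v; have [->|v0] := eqVneq (vnorm (S v)) 0.
  by rewrite mulr_ge0 ?vnorm_ge0 ?ltW.
have v1 : 0 < vnorm (S v) by rewrite lt_neqAle eq_sym v0 vnorm_ge0.
rewrite -(ler_pM2l v1) -expr2.
have -> : vnorm (S v) ^+ 2 = complex.Re (hdot (T (S v)) v).
  by rewrite hS hdot_vnorm.
rewrite (le_trans (cauchy_schwarz_re _ _))// mulrA ler_wpM2r ?vnorm_ge0//.
by rewrite [X in _ <= X]mulrC.
Qed.

Definition adjoint (T : bop) : bop := sval (cid (bop_adjoint T)).

Lemma adjointE (T : bop) u v : hdot (T u) v = hdot u (adjoint T v).
Proof. by rewrite /adjoint; case: cid. Qed.

Lemma adjointP (S T : bop) :
  (forall u v, hdot (T u) v = hdot u (S v)) -> adjoint T = S.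
Proof. by move=> h; apply: bopP => v; apply: hdotr_eq => u; rewrite -adjointE h. Qed.

Fact adjointK : involutive adjoint.
Proof.
by move=> T; apply: adjointP => u v; rewrite hdotC -adjointE -hdotC.
Qed.
Fact adjointD : {morph adjoint : S T / S + T}.
Proof.
move=> S T; apply: adjointP => u v.
by rewrite !bopDE hdotDl hdotDr !adjointE.
Qed.
Fact adjointM (S T : bop) : adjoint (S * T) = adjoint T * adjoint S.
Proof. by apply: adjointP => u v; rewrite !bopME !adjointE. Qed.

HB.instance Definition _ :=
  PzRing_hasStar.Build bop adjointK adjointD adjointM.

Definition opnorm (T : bop) : R :=
  sup [set vnorm (T v) | v in [set v | vnorm v <= 1]].

Let opnorm_has_sup (T : bop) :
  has_sup [set vnorm (T v) | v in [set v | vnorm v <= 1]].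
Proof.
split; first by exists (vnorm (T 0)), 0 => //=; rewrite vnorm0.
have [M M0 h] := bop_gt0 T; exists M => _ [v /= v1 <-].
by rewrite (le_trans (h v))// ger_pMr.
Qed.

Lemma opnorm_ub (T : bop) v : vnorm (T v) <= opnorm T * vnorm v.
Proof.
have [v0|v0] := eqVneq (vnorm v) 0.
  by rewrite (vnorm_eq0 v0) linear0 !vnorm0 mulr0.
have v1 : 0 < vnorm v by rewrite lt_neqAle eq_sym v0 vnorm_ge0.
rewrite -ler_pdivrMr// mulrC -vnormZ ?invr_ge0 ?vnorm_ge0// -linearZ.
apply: ub_le_sup; first exact: (opnorm_has_sup T).2.
exists ((vnorm v)^-1%:C *: v) => //=.
by rewrite vnormZ ?invr_ge0 ?vnorm_ge0// mulVf.
Qed.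

Lemma opnorm_le (T : bop) (c : R) : 0 <= c ->
  (forall v, vnorm (T v) <= c * vnorm v) -> opnorm T <= c.
Proof.
move=> c0 h; apply: ge_sup; first exact: (opnorm_has_sup T).1.
by move=> _ [v /= v1 <-]; rewrite (le_trans (h v))// ler_piMr.
Qed.

Lemma opnorm_ge0 T : 0 <= opnorm T.
Proof.
apply: ub_le_sup; first exact: (opnorm_has_sup T).2.
by exists 0; rewrite /= ?vnorm0// linear0 vnorm0.
Qed.

Lemma opnorm0 : opnorm 0 = 0.
Proof.
apply/eqP; rewrite eq_le opnorm_ge0 opnorm_le// => v.
by rewrite vnorm0 mul0r.
Qed.

Lemma opnormD (S T : bop) : opnorm (S + T) <= opnorm S + opnorm T.
Proof.
apply: opnorm_le => [|v]; first by rewrite addr_ge0 ?opnorm_ge0.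
by rewrite (le_trans (vnormD _ _))// mulrDl lerD ?opnorm_ub.
Qed.

Lemma opnormN (T : bop) : opnorm (- T) = opnorm T.
Proof.
have le (S : bop) : opnorm (- S) <= opnorm S.
  by apply: opnorm_le => [|v]; rewrite ?opnorm_ge0// vnormN opnorm_ub.
by apply/eqP; rewrite eq_le le -{1}[T]opprK le.
Qed.

Lemma opnormB (S T : bop) : opnorm (S - T) = opnorm (T - S).
Proof. by rewrite -opnormN opprB. Qed.

Lemma opnormM (S T : bop) : opnorm (S * T) <= opnorm S * opnorm T.
Proof.
apply: opnorm_le => [|v]; first by rewrite mulr_ge0 ?opnorm_ge0.
rewrite (le_trans (opnorm_ub S (T v)))// -mulrA ler_wpM2l ?opnorm_ge0//.
exact: opnorm_ub.
Qed.

Lemma opnorm_star (T : bop) : opnorm (star T) = opnorm T.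
Proof.
have le (S : bop) : opnorm (star S) <= opnorm S.
  apply: opnorm_le => [|v]; first exact: opnorm_ge0.
  have [->|v0] := eqVneq (vnorm (star S v)) 0.
    by rewrite mulr_ge0 ?vnorm_ge0 ?opnorm_ge0.
  have v1 : 0 < vnorm (star S v) by rewrite lt_neqAle eq_sym v0 vnorm_ge0.
  rewrite -(ler_pM2l v1) -expr2.
  have -> : vnorm (star S v) ^+ 2 = complex.Re (hdot (S (star S v)) v).
    by rewrite adjointE hdot_vnorm.
  rewrite (le_trans (cauchy_schwarz_re _ _))// mulrA ler_wpM2r ?vnorm_ge0//.
  by rewrite mulrC; rewrite mulrC (le_trans (opnorm_ub _ _))// mulrC.
by apply/eqP; rewrite eq_le le -{1}[T]starK le.
Qed.

Definition compact_op (T : bop) : Prop :=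
  precompact (T @` [set v | vnorm v <= 1]).

Lemma compact_op_tb (T : bop) : compact_op T <->
  forall e : R, 0 < e -> exists s : seq H,
    forall v, vnorm v <= 1 -> exists2 c, c \in s & vnorm (T v - c) < e.
Proof.
rewrite /compact_op precompactE; set A := T @` _.
have ballE (c : H) (e : R) v : ball c e%:C v = (vnorm (c - v) < e) :> Prop.
  by rewrite -ball_normE /ball_/= vnormE ltcR.
split=> [cA e e0|tb].
  have e0' : 0 < e%:C :> R[i] by rewrite ltcR.
  move: cA; rewrite compact_cover => /(_ H setT (fun c => ball c e%:C)).
  case=> [c _|v _|D _ AD].
  - exact: ball_open.
  - by exists v => //; exact: ballxx.
  exists (enum_fset D) => v v1.
  have [|c cD] := AD (T v); first by apply: subset_closure; exists v.
  by rewrite /= ballE vnormB => h; exists c.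
rewrite compact_ultra => G UG GA.
have [|w Gw] := @vcauchy_cvg R H G _.
  move=> e e0; have e4 : 0 < e / 4 by rewrite divr_gt0.
  have [s hs] := tb _ e4.
  have : G [set u | exists2 c, c \in s & vnorm (u - c) < e / 2].
    apply: filterS GA => u /(_ [set w | vnorm (u - w) < e / 4]) [].
      have e4' : 0 < (e / 4)%:C :> R[i] by rewrite ltcR.
      apply: filterS (nbhsx_ballx u _ e4') => w.
      by rewrite ballE.
    move=> _ [[v v1 <-] /= uv]; have [c cs vc] := hs v v1; exists c => //.
    rewrite -(subrKA (T v)) (le_lt_trans (vnormD _ _))//.
    by rewrite (lt_le_trans (ltrD uv vc))//; lra.
  have : forall s : seq H, G [set u | exists2 c, c \in s & vnorm (u - c) < e / 2] ->
      exists c, G [set u | vnorm (u - c) < e / 2].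
    elim=> [/filter_ex[u [c]]//|c s' IH GU].
    have [h|h] := in_ultra_setVsetC [set u | vnorm (u - c) < e / 2] UG.
      by exists c.
    apply: IH; apply: filterS (filterI h GU) => u [/= uc [c']].
    by rewrite inE => /orP[/eqP ->//|c's uc']; exists c'.
  move=> /[apply] -[c Gc]; exists [set u | vnorm (u - c) < e / 2] => //.
  move=> u v /= uc vc; rewrite -(subrKA c) (le_lt_trans (vnormD _ _))//.
  by rewrite [X in _ + X]vnormB (lt_le_trans (ltrD uc vc))//; lra.
exists w; split=> //.
apply: (closed_cvg (closure A) _ _ _ Gw); first exact: closed_closure.
by apply: GA.
Qed.

End BoundedOperators.

Section CompactOperators.
Variables (R : realType) (H : hilbertType R).
Implicit Types S T : bop H.

Lemma compact_op0 : compact_op (0 : bop H).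
Proof.
apply/compact_op_tb => e e0; exists [:: 0] => v _.
by exists 0; rewrite ?inE// bop0E subrr vnorm0.
Qed.

Lemma compact_opD S T : compact_op S -> compact_op T -> compact_op (S + T).
Proof.
move=> /compact_op_tb hS /compact_op_tb hT; apply/compact_op_tb => e e0.
have e2 : 0 < e / 2 by rewrite divr_gt0.
have [s hs] := hS _ e2; have [t ht] := hT _ e2.
exists [seq c + d | c <- s, d <- t] => v v1.
have [c cs hc] := hs v v1; have [d dt hd] := ht v v1.
exists (c + d); first by apply/allpairsP; exists (c, d).
rewrite bopDE opprD addrACA (le_lt_trans (vnormD _ _))//.
by rewrite [X in _ < X]splitr ltrD.
Qed.

Lemma compact_opMl S T : compact_op T -> compact_op (S * T).
Proof.
move=> /compact_op_tb hT; apply/compact_op_tb => e e0.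
have [M M0 hM] := bop_gt0 S.
have [t ht] := hT _ (divr_gt0 e0 M0).
exists [seq S c | c <- t] => v v1; have [c ct hc] := ht v v1.
exists (S c); first exact: map_f.
by rewrite bopME -linearB (le_lt_trans (hM _))// mulrC -ltr_pdivlMr.
Qed.

Lemma compact_opN T : compact_op T -> compact_op (- T).
Proof. by move=> cT; rewrite -mulN1r; exact: compact_opMl. Qed.

Lemma compact_op_MstarI T : compact_op (T * star T) -> compact_op (star T).
Proof.
move=> /compact_op_tb hT; apply/compact_op_tb => e e0.
have e1 : 0 < e ^+ 2 / 4 by rewrite divr_gt0 ?exprn_gt0.
have [t ht] := hT _ e1.
pose P c v := vnorm v <= 1 /\ vnorm ((T * star T) v - c) < e ^+ 2 / 4.
exists [seq star T (xget 0 (P c)) | c <- t] => v v1.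
have [c ct hc] := ht v v1; set w := xget 0 (P c).
have [w1 hw] : P c w by apply: (@xgetPex _ 0 (P c)); exists v.
exists (star T w); first by apply/mapP; exists c.
rewrite -linearB -(@ltr_pXn2r _ 2)// ?nnegrE ?vnorm_ge0 ?ltW//.
have -> : vnorm (star T (v - w)) ^+ 2 =
    complex.Re (hdot ((T * star T) (v - w)) (v - w)).
  by rewrite bopME adjointE hdot_vnorm.
rewrite (le_lt_trans (cauchy_schwarz_re _ _))// linearB.
have h1 : vnorm ((T * star T) v - (T * star T) w) < e ^+ 2 / 2.
  rewrite -(subrKA c) (le_lt_trans (vnormD _ _))//.
  by rewrite [X in _ + X]vnormB (lt_le_trans (ltrD hc hw))//; lra.
have h2 : vnorm (v - w) <= 2.
  by rewrite (le_trans (vnormD _ _))// vnormN; lra.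
rewrite (@le_lt_trans _ _ (vnorm ((T * star T) v - (T * star T) w) * 2))//.
  by rewrite ler_wpM2l ?vnorm_ge0.
by rewrite -ltr_pdivlMr.
Qed.

Lemma compact_opMr S T : compact_op S -> compact_op (S * T).
Proof.
move=> /compact_op_tb hS; apply/compact_op_tb => e e0.
have [M M0 hM] := bop_gt0 T.
have [t ht] := hS _ (divr_gt0 e0 M0).
exists [seq M%:C *: c | c <- t] => v v1.
have [|c ct hc] := ht (M^-1%:C *: T v).
  rewrite vnormZ ?invr_ge0 ?(ltW M0)// mulrC ler_pdivrMr// mul1r.
  by rewrite (le_trans (hM v))// ler_piMr// ltW.
exists (M%:C *: c); first exact: map_f.
have -> : (S * T) v = M%:C *: S (M^-1%:C *: T v).
  by rewrite linearZ scalerA -rmorphM divff ?gt_eqF// scale1r.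
by rewrite -scalerBr vnormZ ?(ltW M0)// mulrC -ltr_pdivlMr.
Qed.

Lemma compact_op_star T : compact_op T -> compact_op (star T).
Proof. by move=> cT; exact/compact_op_MstarI/compact_opMr. Qed.

End CompactOperators.

Section Multipliers.
Variables (R : realType) (H : hilbertType R) (X : topologicalType).
Implicit Types f g : X -> bop H.

Definition strongly_continuous f : Prop := forall v, continuous (fun x => f x v).

(* C_b(X, B(H)): the double-strong (strong-* ) topology of B(H) is the initial
   topology for the maps T |-> T v and T |-> star T v, v ranging over H. *)
Definition Cb_strong_star : {pred X -> bop H} := fun f =>
  `[< [/\ exists M : R, forall x, opnorm (f x) <= M,
          strongly_continuous f
        & strongly_continuous (fun x => star (f x))] >].

(* C_0(X, K), for the operator norm; these functions all lie in C_b(X, B(H)), see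
   C0_compact_Cb. The last clause is void when X is compact. *)
Definition C0_compact f : Prop :=
  [/\ forall x, compact_op (f x),
      forall x, opnorm (f y - f x) @[y --> x] --> (0 : R)
    & forall e : R, 0 < e ->
        exists2 K, compact K & forall x, ~ K x -> opnorm (f x) < e].

Lemma strong_contP f : strongly_continuous f <->
  forall v x (e : R), 0 < e -> \forall y \near x, vnorm (f x v - f y v) < e.
Proof.
split=> h v x; first by move=> e e0; have /vcvgP := h v x; exact.
by apply/vcvgP => e e0; exact: h.
Qed.

Lemma strong_cont_cst (T : bop H) : strongly_continuous (fun=> T).
Proof. by move=> v; exact: cst_continuous. Qed.

Lemma strong_contB f g : strongly_continuous f -> strongly_continuous g ->
  strongly_continuous (fun x => f x - g x).
Proof. by move=> hf hg v x; apply: cvgB; [exact: hf|exact: hg]. Qed.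

Lemma strong_contM f g (M : R) : (forall x, opnorm (f x) <= M) ->
  strongly_continuous f -> strongly_continuous g ->
  strongly_continuous (fun x => f x * g x).
Proof.
move=> hM /strong_contP hf /strong_contP hg; apply/strong_contP => v x e e0.
have M0 : 0 <= M by exact: le_trans (opnorm_ge0 _) (hM x).
have e2 : 0 < e / 2 by rewrite divr_gt0.
have e3 : 0 < e / 2 / (M + 1) by rewrite divr_gt0 ?ltr_wpDl.
apply: filterS (filterI (hf (g x v) x _ e2) (hg v x _ e3)) => y [/= h1 h2].
rewrite -[X in vnorm X]/(f x (g x v) - f y (g y v)).
rewrite -(subrKA (f y (g x v))) (le_lt_trans (vnormD _ _))//.
rewrite [X in _ < X]splitr ltr_leD// -linearB (le_trans (opnorm_ub _ _))//.
rewrite (@le_trans _ _ ((M + 1) * vnorm (g x v - g y v)))//.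
  by rewrite ler_wpM2r ?vnorm_ge0// (le_trans (hM y))// lerDl.
by rewrite mulrC -ler_pdivlMr ?ltr_wpDl// ltW.
Qed.

Fact Cb_subring : subring_closed Cb_strong_star.
Proof.
split=> [|f g /asboolP[[M hM] fs fs'] /asboolP[[N hN] gs gs']
         |f g /asboolP[[M hM] fs fs'] /asboolP[[N hN] gs gs']]; apply/asboolP.
- split; [by exists (opnorm (1 : bop H))|exact: strong_cont_cst|].
  by rewrite -[X in strongly_continuous X]/(fun=> star (1 : bop H)); exact: strong_cont_cst.
- split; last 2 first.
  + exact: strong_contB.
  + rewrite [X in strongly_continuous X](_ : _ = fun x => star (f x) - star (g x)).
      exact: strong_contB.
    by apply/funext => x; rewrite starB.
  exists (M + N) => x; rewrite (le_trans (opnormD _ _))// lerD// opnormN//.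
- split; last 2 first.
  + exact: (strong_contM hM).
  + rewrite [X in strongly_continuous X](_ : _ = fun x => star (g x) * star (f x)).
      by apply: (@strong_contM _ _ N) => // x; rewrite opnorm_star.
    by apply/funext => x; rewrite starM.
  exists (M * N) => x; rewrite (le_trans (opnormM _ _))// ler_pM ?opnorm_ge0//.
Qed.

HB.instance Definition _ :=
  GRing.isSubringClosed.Build (X -> bop H) Cb_strong_star Cb_subring.

(* M(I) for I = C(X) (x) K *)
Record multiplier := Multiplier {
  multiplier_fun :> X -> bop H;
  multiplierP : multiplier_fun \in Cb_strong_star
}.

HB.instance Definition _ := [isSub for multiplier_fun].
HB.instance Definition _ := [Choice of multiplier by <:].
HB.instance Definition _ :=
  GRing.SubChoice_isSubPzRing.Build _ _ multiplier (GRing.subringClosedP _).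

Lemma multiplier_eq (a b : multiplier) : (forall x, a x = b x) -> a = b.
Proof. by move=> h; apply: val_inj; exact/funext. Qed.

Fact multiplier_star_subproof (a : multiplier) :
  (fun x => star (a x)) \in Cb_strong_star.
Proof.
have /asboolP[[M hM] as1 as2] := multiplierP a; apply/asboolP; split=> //.
  by exists M => x; rewrite opnorm_star.
rewrite [X in strongly_continuous X](_ : _ = multiplier_fun a)//.
by apply/funext => x; rewrite starK.
Qed.

Definition multiplier_star (a : multiplier) :=
  Multiplier (multiplier_star_subproof a).

Fact multiplier_starK : involutive multiplier_star.
Proof. by move=> a; apply: multiplier_eq => x /=; rewrite starK. Qed.
Fact multiplier_starD : {morph multiplier_star : a b / a + b}.
Proof. by move=> a b; apply: multiplier_eq => x /=; rewrite starD. Qed.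
Fact multiplier_starM (a b : multiplier) :
  multiplier_star (a * b) = multiplier_star b * multiplier_star a.
Proof. by apply: multiplier_eq => x /=; rewrite starM. Qed.

HB.instance Definition _ := PzRing_hasStar.Build multiplier
  multiplier_starK multiplier_starD multiplier_starM.

Lemma norm_contP f x : (opnorm (f y - f x) @[y --> x] --> (0 : R)) <->
  forall e : R, 0 < e -> \forall y \near x, opnorm (f y - f x) < e.
Proof.
split=> [/cvgrPdist_lt h e e0|h].
  by apply: filterS (h _ e0) => y; rewrite sub0r normrN ger0_norm ?opnorm_ge0.
apply/cvgrPdist_lt => e e0; apply: filterS (h _ e0) => y.
by rewrite sub0r normrN ger0_norm ?opnorm_ge0.
Qed.

Lemma strong_cont_compact f (M : R) (T : bop H) x :
  (forall x, opnorm (f x) <= M) -> strongly_continuous f -> compact_op T ->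
  forall e : R, 0 < e -> \forall y \near x, opnorm ((f y - f x) * T) < e.
Proof.
move=> hM /strong_contP hf /compact_op_tb hT e e0.
have M0 : 0 <= M by exact: le_trans (opnorm_ge0 _) (hM x).
pose d := e / 4 / (M * 2 + 1).
have K0 : 0 < M * 2 + 1 by rewrite ltr_wpDl// mulr_ge0.
have d0 : 0 < d by rewrite !divr_gt0.
have e4 : 0 < e / 4 by rewrite divr_gt0.
have [s hs] := hT _ d0.
have : \forall y \near x, forall c, c \in s -> vnorm (f x c - f y c) < e / 4.
  elim: s {hs} => [|c s IH]; first exact: nearW.
  apply: filterS (filterI (hf c x _ e4) IH) => y [/= h1 h2] c'.
  by rewrite inE => /orP[/eqP ->|/h2].
apply: filterS => y hy; apply: (@le_lt_trans _ _ (e / 2)); last first.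
  by rewrite ltr_pdivrMr// ltr_pMr// ltr1n.
have bnd v : vnorm v <= 1 -> vnorm (((f y - f x) * T) v) <= e / 2.
  move=> v1; have [c cs hc] := hs v v1.
  rewrite bopME -(subrK c (T v)) linearD (le_trans (vnormD _ _))//.
  have h1 : vnorm ((f y - f x) c) <= e / 4.
    by rewrite bopBE vnormB ltW// hy.
  have h2 : vnorm ((f y - f x) (T v - c)) <= e / 4.
    rewrite (le_trans (opnorm_ub _ _))//.
    rewrite (@le_trans _ _ ((M * 2 + 1) * d))//; last first.
      by rewrite /d mulrC divfK ?gt_eqF.
    apply: ler_pM; rewrite ?opnorm_ge0 ?vnorm_ge0 ?(ltW hc)//.
    rewrite (le_trans (opnormD _ _))// opnormN.
    by have := hM x; have := hM y; lra.
  by lra.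
apply: ge_sup; first by exists (vnorm (((f y - f x) * T) 0)), 0 => //=; rewrite vnorm0.
by move=> _ [v /= v1 <-]; exact: bnd.
Qed.

Definition C0_ideal : {pred multiplier} := fun a => `[< C0_compact a >].

Fact C0_ideal_zmod : zmod_closed C0_ideal.
Proof.
split=> [|a b /asboolP[ac an av] /asboolP[bc bn bv]]; apply/asboolP.
  split=> [x|x|e e0]; first exact: compact_op0.
    apply/norm_contP => e e0; apply: nearW => y.
    by rewrite /= subrr opnorm0.
  by exists set0 => [|x _]; [exact: compact0|rewrite opnorm0].
split=> [x|x|e e0]; first by apply: compact_opD => //; exact: compact_opN.
  apply/norm_contP => e e0; have e2 : 0 < e / 2 by rewrite divr_gt0.
  have /norm_contP/(_ _ e2) h1 := an x; have /norm_contP/(_ _ e2) h2 := bn x.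
  apply: filterS (filterI h1 h2) => y [/= k1 k2].
  have -> : a y - b y - (a x - b x) = (a y - a x) - (b y - b x).
    by rewrite !opprD !opprK addrACA.
  by rewrite (le_lt_trans (opnormD _ _))// opnormN [X in _ < X]splitr ltrD.
have e2 : 0 < e / 2 by rewrite divr_gt0.
have [K cK hK] := av _ e2; have [L cL hL] := bv _ e2.
exists (K `|` L); first exact: compactU.
move=> x KL; rewrite (le_lt_trans (opnormD _ _))// opnormN [X in _ < X]splitr.
by rewrite ltrD ?hK ?hL// => ?; apply: KL; [left|right].
Qed.

Fact C0_ideal_mull (a b : multiplier) : b \in C0_ideal -> a * b \in C0_ideal.
Proof.
have /asboolP[[M hM] as1 _] := multiplierP a.
move=> /asboolP[bc bn bv]; apply/asboolP; split=> [x|x|e e0].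
- exact: compact_opMl.
- have M0 : 0 <= M by exact: le_trans (opnorm_ge0 _) (hM x).
  apply/norm_contP => e e0; have e2 : 0 < e / 2 by rewrite divr_gt0.
  have e3 : 0 < e / 2 / (M + 1) by rewrite divr_gt0 ?ltr_wpDl.
  have /norm_contP/(_ _ e3) h1 := bn x.
  have h2 := strong_cont_compact x hM as1 (bc x) e2.
  apply: filterS (filterI h1 h2) => y [/= k1 k2].
  have -> : a y * b y - a x * b x = a y * (b y - b x) + (a y - a x) * b x.
    by rewrite mulrBr mulrBl subrKA.
  rewrite (le_lt_trans (opnormD _ _))// [X in _ < X]splitr ler_ltD//.
  rewrite (le_trans (opnormM _ _))// (@le_trans _ _ ((M + 1) * opnorm (b y - b x)))//.
    by rewrite ler_wpM2r ?opnorm_ge0// (le_trans (hM y))// lerDl.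
  by rewrite mulrC -ler_pdivlMr ?ltr_wpDl// ltW.
have M1 : 0 < `|M| + 1 by rewrite ltr_wpDl.
have [K cK hK] := bv _ (divr_gt0 e0 M1).
exists K => // x /hK; rewrite ltr_pdivlMr// mulrC; apply: le_lt_trans.
rewrite (le_trans (opnormM _ _))// ler_wpM2r ?opnorm_ge0//.
by rewrite (le_trans (hM x))// ler_wpDr// ler_norm.
Qed.

Fact C0_ideal_star (a : multiplier) : a \in C0_ideal -> star a \in C0_ideal.
Proof.
move=> /asboolP[ac an av]; apply/asboolP; split=> [x|x|e e0].
- exact: compact_op_star.
- apply/norm_contP => e e0; have /norm_contP/(_ _ e0) := an x.
  by apply: filterS => y; rewrite -starB opnorm_star.
- have [K cK hK] := av _ e0; exists K => // x /hK.
  by rewrite -[X in _ -> X]/(is_true (opnorm (star (a x)) < e)) opnorm_star.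
Qed.

HB.instance Definition _ :=
  GRing.isZmodClosed.Build multiplier C0_ideal C0_ideal_zmod.
HB.instance Definition _ := isStarIdeal.Build multiplier C0_ideal
  C0_ideal_mull C0_ideal_star.

Lemma C0_compact_Cb f : C0_compact f -> f \in Cb_strong_star.
Proof.
move=> [_ fn fv]; apply/asboolP.
have fs (g : X -> bop H) : (forall x, opnorm (g y - g x) @[y --> x] --> (0 : R)) ->
    strongly_continuous g.
  move=> gn; apply/strong_contP => v x e e0.
  have v1 : 0 < vnorm v + 1 by rewrite ltr_wpDl ?vnorm_ge0.
  have /norm_contP/(_ _ (divr_gt0 e0 v1)) := gn x; apply: filterS => y.
  rewrite ltr_pdivlMr//; apply: le_lt_trans.
  rewrite vnormB -bopBE (le_trans (opnorm_ub _ _))//.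
  by rewrite ler_wpM2l ?opnorm_ge0// lerDl.
split; [|exact: fs|]; last first.
  apply: fs => x; apply/norm_contP => e e0; have /norm_contP/(_ _ e0) := fn x.
  by apply: filterS => y; rewrite -starB opnorm_star.
have [K cK hK] := fv 1 ltr01.
have fc : continuous (fun x => opnorm (f x)).
  move=> x; apply/cvgrPdist_lt => e e0; have /norm_contP/(_ _ e0) := fn x.
  apply: filterS => y; apply: le_lt_trans.
  have h1 := opnormD (f y - f x) (f x); have h2 := opnormD (f x - f y) (f y).
  rewrite !subrK in h1 h2; rewrite opnormB in h2.
  by rewrite ler_norml; apply/andP; split; lra.
have : compact ((fun x => opnorm (f x)) @` K).
  by apply: continuous_compact => //; exact: continuous_subspaceT.
move=> /compact_bounded[N [_ hN]]; exists (`|N| + 1 + 1) => x.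
have [Kx|nKx] := pselect (K x); last first.
  by rewrite (le_trans (ltW (hK x nKx)))// lerDr.
have := hN (`|N| + 1); rewrite ltr_pwDr ?ler_norm// => /(_ isT (opnorm (f x))).
rewrite /= ger0_norm ?opnorm_ge0// => h.
by rewrite (le_trans (h _))// ?lerDl//; exists x.
Qed.

End Multipliers.

Definition separable (R : realType) (H : hilbertType R) : Prop :=
  exists2 D : set H, countable D & dense D.

Definition finite_dimensional (R : realType) (H : hilbertType R) : Prop :=
  exists (n : nat) (e : 'I_n -> H),
    forall v, exists c : 'I_n -> R[i], v = \sum_i c i *: e i.

Definition corona (R : realType) (H : hilbertType R) (X : topologicalType) :
  starRingType := @star_quot (multiplier H X) (@C0_ideal R H X).

Definition corona_pi (R : realType) (H : hilbertType R) (X : topologicalType) :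
  starMorphism (multiplier H X) (corona H X) :=
  @star_quot_pi (multiplier H X) (@C0_ideal R H X).

Section Circle.
Variable R : realType.

Definition unit_interval : topologicalType := set_type `[0 : R, 1].

Definition is_endpoint (x : unit_interval) : bool :=
  (set_val x == 0 :> R) || (set_val x == 1 :> R).

(* [0, 1] / {0, 1} *)
Definition circle_rel (x y : unit_interval) : bool :=
  (x == y) || (is_endpoint x && is_endpoint y).

Fact circle_rel_refl : reflexive circle_rel.
Proof. by move=> x; rewrite /circle_rel eqxx. Qed.
Fact circle_rel_sym : symmetric circle_rel.
Proof. by move=> x y; rewrite /circle_rel eq_sym andbC. Qed.
Fact circle_rel_trans : transitive circle_rel.
Proof.
move=> y x z /orP[/eqP -> //|/andP[hx hy]] /orP[/eqP <-|/andP[_ hz]].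
  by rewrite /circle_rel hx hy orbT.
by rewrite /circle_rel hx hz orbT.
Qed.

Canonical circle_equiv :=
  EquivRel circle_rel circle_rel_refl circle_rel_sym circle_rel_trans.

Definition circle : topologicalType := quotient_topology {eq_quot circle_rel}.

End Circle.

Variant base_kind := Line | Circle.

Definition base_space (R : realType) (k : base_kind) : topologicalType :=
  match k with
  | Line => R
  | Circle => circle R
  end.

Definition K0_liftable (A B : starRingType) (f : starMorphism A B) (x : K0 B) : Prop :=
  exists y : K0 A, K0_map f y = x.

Definition proj_liftable (A B : starRingType) (f : starMorphism A B) n
    (p : 'M[B]_n) : Prop :=
  exists2 q : 'M[A]_n, is_proj q & map_mx f q = p.

(* Main.v *)
Require Import Defs.
From mathcomp Require Import all_boot all_order all_algebra.
From mathcomp Require Import complex.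
From mathcomp Require Import all_classical all_reals all_analysis.
From mathcomp Require Import lra ring.
Import Order.TTheory GRing.Theory Num.Theory.
Import numFieldNormedType.Exports.

(* An Eilenberg swindle in M(I) shows that [q] + [1] = [1] in V_0(M(I)) for every
   projection q over M(I), whatever the space X. Hence, if [p]_0 lifts, p (+) 1_n is
   Murray-von Neumann equivalent to 1 over C(I), i.e. p (+) 1_n = t t^* with
   t^* t = 1. Let T lift t and a = T^* T, so that 1 - a lies in I. The summand 0_n
   leaves room for the column W = (T, 1 - a, 0), another lift of (t, 0, 0), for which
   W^* W = 1 - a + a^2 >= 3/4 is invertible, and W (W^* W)^-1 W^* is a projection
   lifting p (+) 1_n (+) 0_n. The converse is K_0 arithmetic. *)

Set Implicit Arguments.
Unset Strict Implicit.
Unset Printing Implicit Defensive.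

Local Open Scope ring_scope.
Local Open Scope classical_set_scope.
Local Open Scope complex_scope.

(** * Projections over *-rings *)

Section UnitProjections.
Variable A : starRingType.

Lemma mxstar1 n : mxstar (1%:M : 'M[A]_n) = 1%:M.
Proof.
apply/matrixP => i j; rewrite !mxE eq_sym.
by case: (i == j); rewrite ?star1 ?star0.
Qed.

Lemma is_proj1 n : is_proj (1%:M : 'M[A]_n).
Proof. by split; rewrite ?mxstar1 ?mulmx1. Qed.

Lemma mxstarB m n (v w : 'M[A]_(m, n)) : mxstar (v - w) = mxstar v - mxstar w.
Proof. by apply/matrixP => i j; rewrite !mxE starB. Qed.

Lemma mxstar_row m n1 n2 (v : 'M[A]_(m, n1)) (w : 'M[A]_(m, n2)) :
  mxstar (row_mx v w) = col_mx (mxstar v) (mxstar w).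
Proof. by rewrite /mxstar tr_row_mx map_col_mx. Qed.

Lemma mxstar_col m1 m2 n (v : 'M[A]_(m1, n)) (w : 'M[A]_(m2, n)) :
  mxstar (col_mx v w) = row_mx (mxstar v) (mxstar w).
Proof. by rewrite /mxstar tr_col_mx map_row_mx. Qed.

Lemma is_proj_compl n (p : 'M[A]_n) : is_proj p -> is_proj (1%:M - p).
Proof.
move=> [ps pp]; split; first by rewrite mxstarB mxstar1 ps.
by rewrite mulmxBl mul1mx mulmxBr mulmx1 pp subrr subr0.
Qed.

(** The row [(p, 1 - p)] is a partial isometry between the two sides, because [p (1 - p) = 0]. *)
Lemma V0_compl n (p : 'M[A]_n) (hp : is_proj p) :
  V0_class hp + V0_class (is_proj_compl hp) = V0_class (is_proj1 n).
Proof.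
have [cs cc] := is_proj_compl hp; have [ps pp] := hp.
rewrite V0_addDE; apply/V0_classP; exists (row_mx p (1%:M - p)).
rewrite mxstar_row ps cs mul_col_row mul_row_col pp cc subrKC; split=> //.
by rewrite mulmxBr mulmxBl mulmx1 mul1mx pp subrr.
Qed.

Lemma V0_1D m n :
  V0_class (is_proj1 m) + V0_class (is_proj1 n) = V0_class (is_proj1 (m + n)).
Proof.
rewrite V0_addDE; apply/V0_classP.
by rewrite -scalar_mx_block; exact/mvn_refl/is_proj1.
Qed.

(** The zero of the monoid is the class of the empty matrix, so the witness has no rows. *)
Lemma V0_0 n : V0_class (is_proj0 A n) = 0.
Proof.
by apply/V0_classP; exists 0; rewrite !(mxstar0, mul0mx, mulmx0).
Qed.

End UnitProjections.

Lemma V0_map1 (A B : starRingType) (f : starMorphism A B) n :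
  V0_map f (V0_class (is_proj1 A n)) = V0_class (is_proj1 B n).
Proof.
rewrite V0_mapE; apply/V0_classP; rewrite map_mx1.
exact/mvn_refl/is_proj1.
Qed.

(** * Absorption in V_0(A) and its effect on liftable classes *)

Section Absorption.
Variable A : starRingType.
Hypothesis V0_absorb : forall x : V0 A,
  x + V0_class (is_proj1 A 1) = V0_class (is_proj1 A 1).
Variables (B : starRingType) (f : starMorphism A B).

Lemma V0_1_absorb x : V0_map f x + V0_class (is_proj1 B 1) = V0_class (is_proj1 B 1).
Proof. by rewrite -(V0_map1 f) -raddfD V0_absorb. Qed.

(** [[1]] comes from [A], so it absorbs itself. Sizes start at one because the empty unit matrix has
    class 0. *)
Lemma V0_1S n : V0_class (is_proj1 B n.+1) = V0_class (is_proj1 B 1).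
Proof.
elim: n => // n IH; rewrite -addn1 -V0_1D IH.
by rewrite -{1}(V0_map1 f) V0_1_absorb.
Qed.

Lemma K0_liftable_absorb m (p : 'M[B]_m) (hp : is_proj p) :
  K0_liftable f (K0_class hp) ->
  V0_class hp + V0_class (is_proj1 B 1) = V0_class (is_proj1 B 1).
Proof.
set e := V0_class (is_proj1 B 1).
case; elim/groth_ind => a b.
have -> : K0_map f (groth_sub a b) = groth_sub (V0_map f a) (V0_map f b).
  exact: groth_mapE.
move=> /groth_subP[]; elim/V0_ind => k c hc; rewrite addr0 => h.
(* The relation in the Grothendieck group holds up to some [c] over [B], which need not come from
   [A]; adding its complement turns it into a unit matrix, which merges into [e]. *)
have ce : V0_class hc + (V0_class (is_proj_compl hc) + e) = e.
  by rewrite addrA V0_compl V0_1D addn1 V0_1S.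
have := congr1 (+%R^~ (V0_class (is_proj_compl hc) + e)) h.
by rewrite -!addrA ce !V0_1_absorb => <-.
Qed.

End Absorption.

(** * Eilenberg swindle from two isometries with complementary ranges *)

Section Swindle.
Variables (A : starRingType) (s t : A).
Hypotheses (s_iso : star s * s = 1) (t_iso : star t * t = 1).
Hypothesis st1 : s * star s + t * star t = 1.

(** Multiplying [st1] by [star s] on the left and [t] on the right gives
    [star s * t + star s * t = star s * t]. *)
Lemma isometry_orth : star s * t = 0.
Proof.
have := congr1 (fun x => star s * x * t) st1.
rewrite /= mulr1 mulrDr mulrDl !mulrA s_iso mul1r -!mulrA t_iso mulr1.
by rewrite -[X in _ = X -> _]add0r => /addIr.
Qed.

Lemma isometry_orthV : star t * s = 0.
Proof. by rewrite -[LHS]starK starM starK isometry_orth star0. Qed.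

(** The isometries [t ^+ i * s] have pairwise orthogonal ranges; conjugation by this row compresses
    projections of size [n] to size one. *)
Definition isometry_row n : 'M[A]_(1, n) := \row_i (t ^+ i * s).

(** Cancelling [star t * t] lowers both exponents until one is 0; unequal exponents then leave a
    factor [star s * t] or its adjoint. *)
Lemma isometry_rowP n : mxstar (isometry_row n) *m isometry_row n = 1%:M.
Proof.
have X0 k : star s * t ^+ k.+1 = 0 by rewrite exprS mulrA isometry_orth mul0r.
have Xi i j : star (t ^+ i * s) * (t ^+ j * s) = (i == j)%:R.
  elim: i j => [|i IH] [|j].
  - by rewrite expr0 mul1r s_iso.
  - by rewrite expr0 mul1r mulrA X0 mul0r.
  - by rewrite expr0 mul1r -[LHS]starK starM starK mulrA X0 mul0r star0.
  - rewrite eqSS -IH !exprS !starM -!mulrA; congr (_ * _).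
    by rewrite !mulrA -(mulrA _ (star t)) t_iso mulr1.
by apply/matrixP => i j; rewrite !mxE big_ord1 !mxE Xi.
Qed.

(* [y] plays the role of the direct sum of infinitely many copies of [x]. *)
Hypothesis swindle : forall x : A, star x = x -> x * x = x ->
  exists y, [/\ star y = y, y * y = y & y = s * x * star s + t * y * star t].

(** Once compressed to a projection [q] of size one, the class satisfies [[q] + [y] = [y]]; adding
    [[1 - y]] to both sides replaces [[y]] by [[1]]. *)
Lemma V0_absorb x : x + V0_class (is_proj1 A 1) = V0_class (is_proj1 A 1).
Proof.
elim/V0_ind: x => n p hp; have [ps pp] := hp.
pose w := isometry_row n; have ww := isometry_rowP n; rewrite -/w in ww.
pose q := w *m p *m mxstar w.
have hq : is_proj q.
  split; first by rewrite /q !mxstarM mxstarK ps mulmxA.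
  by rewrite /q -!mulmxA (mulmxA _ w) ww mul1mx (mulmxA p p) pp.
have -> : V0_class hp = V0_class hq.
  apply/V0_classP; exists (w *m p); rewrite mxstarM ps; split.
    by rewrite -mulmxA (mulmxA _ w) ww mul1mx.
  by rewrite /q -!mulmxA (mulmxA p p) pp.
clear ww; clearbody q.
have qE : q = (q 0 0)%:M by apply/matrixP => i j; rewrite !ord1 mxE eqxx mulr1n.
have [qs qq] := hq; set x := q 0 0 in qE.
have xs : star x = x by have := congr1 (fun z : 'M[A]_1 => z 0 0) qs; rewrite 2!mxE.
have xx : x * x = x.
  by have := congr1 (fun z : 'M[A]_1 => z 0 0) qq; rewrite mxE big_ord1.
have [y [ys yy yE]] := swindle xs xx.
have sS (z : A) : mxstar (z%:M : 'M[A]_1) = (star z)%:M.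
  by apply/matrixP => i j; rewrite !ord1 !mxE eqxx !mulr1n.
have hy : is_proj (y%:M : 'M[A]_1) by split; rewrite ?sS ?ys -?scalar_mxM ?yy.
suff qy : V0_class hq + V0_class hy = V0_class hy.
  by rewrite -(V0_compl hy) addrA qy.
rewrite V0_addDE; apply/V0_classP; rewrite qE.
(* The ranges of [s] and [t] are orthogonal, so this row is a partial isometry from the direct sum
   of [x] and [y] onto [s * x * star s + t * y * star t], which is [y]. *)
exists (row_mx (s * x)%:M (t * y)%:M).
rewrite mxstar_row !sS mul_col_row mul_row_col !starM xs ys -!scalar_mxM.
rewrite !mulrA -!(mulrA _ (star _)) s_iso t_iso isometry_orth isometry_orthV.
rewrite !mulr0 !mul0r !mulr1 !raddf0 -raddfD /= xx yy; split=> //.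
by rewrite -(mulrA s) xx -(mulrA t) yy -yE.
Qed.

End Swindle.

(** [y n] is the sum of [d ^+ i * c * e ^+ i] over [i < n]. This one formula for the increments
    serves both the swindle ([d = T], [e = star T]) and the Neumann series ([e = 1]). *)
Lemma iter_affine (A : pzRingType) (c d e : A)
    (y := fun n => iter n (fun z => c + d * z * e) 0) (n k : nat) : y (n + k)%N = y n + d ^+ n * y k * e ^+ n.
Proof.
elim: n => [|n IH]; first by rewrite !expr0 mul1r mulr1 add0r.
rewrite addSn /y !iterS -/(y (n + k)%N) -/(y n) -/(y k) IH exprS exprSr.
by rewrite mulrDr mulrDl !mulrA addrA.
Qed.

Lemma star_exp (A : starRingType) (a : A) n : star (a ^+ n) = star a ^+ n.
Proof. by elim: n => [|n IH]; rewrite ?star1// exprS starM IH -exprSr. Qed.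

Lemma isometry_exp (A : starRingType) (t : A) n :
  star t * t = 1 -> star (t ^+ n) * t ^+ n = 1.
Proof.
move=> tt; elim: n => [|n IH]; first by rewrite expr0 star1 mulr1.
by rewrite exprS starM mulrA -(mulrA _ (star t)) tt mulr1.
Qed.

(** * Strong limits *)

Section StrongLimits.
Variables (R : realType) (H : hilbertType R).
Implicit Types (u : nat -> H) (l : H) (S T : bop H).

Lemma vseqP u l : (u @ \oo --> l) <->
  forall e : R, 0 < e -> exists N, forall n, (N <= n)%N -> vnorm (l - u n) < e.
Proof.
split=> [/vcvgP h e /h[N _ hN]|h]; first by exists N.
by apply/vcvgP => e /h[N hN]; exists N.
Qed.

Lemma vlim_unique u (l l' : H) :
  u n @[n --> \oo] --> l -> u n @[n --> \oo] --> l' -> l = l'.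
Proof. by move=> h h'; exact: (cvg_unique _ h h'). Qed.

Lemma vlim_bop T u l : u @ \oo --> l -> T (u n) @[n --> \oo] --> T l.
Proof.
move=> /vseqP h; have [M M0 hM] := bop_gt0 T; apply/vseqP => e e0.
have [N hN] := h _ (divr_gt0 e0 M0); exists N => n /hN.
rewrite ltr_pdivlMr// mulrC -linearB; exact/le_lt_trans/hM.
Qed.

Lemma vcauchy_seq u :
  (forall e : R, 0 < e -> exists N, forall m n, (N <= m)%N -> (N <= n)%N ->
    vnorm (u m - u n) < e) ->
  exists l, u @ \oo --> l.
Proof.
move=> h; apply: vcauchy_cvg => e /h[N hN]; exists (u @` [set n | (N <= n)%N]).
  by exists N => // n /= Nn; exists n.
by move=> _ _ [m /= Nm <-] [n /= Nn <-]; exact: hN.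
Qed.

Lemma vlim_le u l (M : R) :
  (forall n, vnorm (u n) <= M) -> u n @[n --> \oo] --> l -> vnorm l <= M.
Proof.
move=> hM /vseqP h; apply/ler_addgt0Pr => e /h[N /(_ N (leqnn N)) hN].
have := vnormD (l - u N) (u N); rewrite subrK; have := hM N; lra.
Qed.

Lemma vlim_hdotl v u l : u @ \oo --> l ->
  hdot (u n) v @[n --> \oo] --> (hdot l v : R[i]^o).
Proof.
move=> /vseqP h; apply/cvgrPdist_lt => e e0.
have eE := ger0_ReK (ltW e0); have e1 : 0 < complex.Re e by rewrite -ltcR -eE.
have v1 : 0 < vnorm v + 1 by rewrite ltr_wpDl ?vnorm_ge0.
have [N hN] := h _ (divr_gt0 e1 v1); exists N => // n /hN /=.
rewrite ltr_pdivlMr// => hn; rewrite eE -hdotNl -hdotDl.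
rewrite (le_lt_trans (cauchy_schwarz _ _))// ltcR (le_lt_trans _ hn)//.
by rewrite ler_wpM2l ?vnorm_ge0 ?lerDl.
Qed.

Lemma vlim_hdotr v u l : u @ \oo --> l ->
  hdot v (u n) @[n --> \oo] --> (hdot v l : R[i]^o).
Proof.
move=> /(@vlim_hdotl v)/cvgrPdist_lt h; apply/cvgrPdist_lt => e /h.
apply: filterS => n /=.
by rewrite -hdotNl -hdotDl -hdotNr -hdotDr (hdotC v) norm_conjC.
Qed.

(** Completeness gives the pointwise limits; linearity and the common bound pass to them. *)
Lemma bop_strong_lim (T : nat -> bop H) (M : R) :
  (forall n v, vnorm (T n v) <= M * vnorm v) ->
  (forall v (e : R), 0 < e -> exists N, forall m n, (N <= m)%N -> (N <= n)%N ->
    vnorm (T m v - T n v) < e) ->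
  exists2 S : bop H, forall v, T n v @[n --> \oo] --> S v &
    forall v, vnorm (S v) <= M * vnorm v.
Proof.
move=> hM h; have /choice[S hS] v := vcauchy_seq (h v).
have Sl : linear S.
  move=> a u v; apply: (vlim_unique (hS _)).
  under eq_fun do rewrite linearP.
  by apply: cvgD (hS v); apply: cvgZl_tmp (hS u).
have Sb v : vnorm (S v) <= M * vnorm v by exact: vlim_le (hM^~ v) (hS v).
by exists (Bop Sl (ex_intro _ M Sb)).
Qed.

End StrongLimits.

(** * Strong limits of self-adjoint multipliers *)

Section MultiplierLimits.
Variables (R : realType) (H : hilbertType R) (X : topologicalType).
Local Notation M := (multiplier H X).

(** For each vector the Cauchy condition is uniform over [X], so strong continuity survives in the
    limit; self-adjointness then gives it for the adjoint as well. *)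
Lemma multiplier_lim (y : nat -> M) (C : R) :
  (forall n, star (y n) = y n) ->
  (forall n x v, vnorm (y n x v) <= C * vnorm v) ->
  (forall v (e : R), 0 < e -> exists N, forall m n, (N <= m)%N -> (N <= n)%N ->
    forall x, vnorm (y m x v - y n x v) < e) ->
  exists2 l : M, star l = l & forall x v, y n x v @[n --> \oo] --> l x v.
Proof.
move=> ys yC yc.
have /choice[l hl] x : exists S : bop H, (forall v, y n x v @[n --> \oo] --> S v)
    /\ forall v, vnorm (S v) <= C * vnorm v.
  have [||S h1 h2] := @bop_strong_lim R H (fun n => y n x) C.
  - by move=> n v; exact: yC.
  - by move=> v e /(yc v)[N hN]; exists N => m n Nm Nn; exact: hN.
  - by exists S.
have lC x v : vnorm (l x v) <= C * vnorm v by case: (hl x).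
have lv x v : y n x v @[n --> \oo] --> l x v by case: (hl x).
have lstar x : star (l x) = l x.
  apply: adjointP => u v.
  have ns n : hdot (y n x u) v = hdot u (y n x v).
    rewrite adjointE -[adjoint _]/(multiplier_star (y n) x).
    by rewrite -[multiplier_star _]/(star (y n)) ys.
  have := vlim_hdotr (v := u) (lv x v); under eq_fun do rewrite -ns.
  exact: cvg_unique (vlim_hdotl (v := v) (lv x u)).
have lsc : strongly_continuous l.
  apply/strong_contP => v x e e0.
  have e6 : 0 < e / 6 by rewrite divr_gt0.
  have [N hN] := yc v _ e6.
  (* [N'] depends on [z] but [N] does not: passing through the rank [maxn N N'] bounds [l - y N]
     uniformly in [z]. *)
  have yl z : vnorm (l z v - y N z v) < e / 3.
    have /vseqP/(_ _ e6)[N' hN'] := lv z v.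
    have := hN' _ (leq_maxr N N'); have := hN _ _ (leq_maxl N N') (leqnn N) z.
    have := vnormD (l z v - y (maxn N N') z v) (y (maxn N N') z v - y N z v).
    by rewrite subrKA; lra.
  have /asboolP[_ /strong_contP/(_ v x _ (divr_gt0 e0 (ltr0n _ 3))) + _] :=
    multiplierP (y N).
  apply: filterS => z hz.
  have := yl x; have := yl z; rewrite (vnormB (l z v)).
  have := vnormD (l x v - y N x v) (y N x v - y N z v).
  have := vnormD (l x v - y N z v) (y N z v - l z v).
  by rewrite !subrKA; lra.
have lM : l \in @Cb_strong_star R H X.
  apply/asboolP; split=> //; last by under eq_fun do rewrite lstar.
  exists `|C| => x; apply: opnorm_le => // v.
  by rewrite (le_trans (lC x v))// ler_wpM2r ?vnorm_ge0 ?ler_norm.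
by exists (Multiplier lM) => //; apply: multiplier_eq => x; exact: lstar.
Qed.

End MultiplierLimits.

(** * Operators and multipliers *)

Section Operators.
Variables (R : realType) (H : hilbertType R).
Implicit Types (S T : bop H) (u v : H).

Lemma bop_starE T u v : hdot (star T u) v = hdot u (T v).
Proof. by rewrite adjointE -[adjoint _]/(star (star T)) starK. Qed.

Lemma vnorm_hdot v : vnorm v ^+ 2 = complex.Re (hdot v v).
Proof. by rewrite hdot_vnorm. Qed.

Lemma isometry_vnorm T v : star T * T = 1 -> vnorm (T v) = vnorm v.
Proof.
move=> TT; apply/eqP; rewrite -(@eqrXn2 _ 2)// ?vnorm_ge0//.
by rewrite !vnorm_hdot -bop_starE -bopME TT.
Qed.

(** The square of [vnorm (T v)] is the real part of [hdot (T v) v]; apply Cauchy-Schwarz and divide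
    by [vnorm (T v)]. *)
Lemma proj_vnorm T v : star T = T -> T * T = T -> vnorm (T v) <= vnorm v.
Proof.
move=> sT TT; have [->|v0] := eqVneq (vnorm (T v)) 0; first exact: vnorm_ge0.
have v1 : 0 < vnorm (T v) by rewrite lt_neqAle eq_sym v0 vnorm_ge0.
rewrite -(ler_pM2r v1) -expr2 vnorm_hdot -bop_starE sT -bopME TT hdot_ReC.
exact: cauchy_schwarz_re.
Qed.

Lemma scale_bop_linear (c : R) : linear (fun v : H => c%:C *: v).
Proof. by move=> a u v; rewrite scalerDr !scalerA mulrC. Qed.

Lemma scale_bop_bounded (c : R) :
  exists M : R, forall v : H, vnorm (c%:C *: v) <= M * vnorm v.
Proof.
exists `|c| => v; rewrite -lecR rmorphM /= -!vnormE normrZ.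
by rewrite normc_def /= expr0n addr0 sqrtr_sqr.
Qed.

(** Operators form only a ring here, so real scalars enter as central self-adjoint operators. *)
Definition scale_bop (c : R) : bop H :=
  Bop (scale_bop_linear c) (scale_bop_bounded c).

Lemma scale_bop_star c : star (scale_bop c) = scale_bop c.
Proof. by apply: adjointP => u v /=; rewrite hdotZl hdotZr conjc_real. Qed.

Lemma scale_bopC c T : scale_bop c * T = T * scale_bop c.
Proof. by apply: bopP => v; rewrite !bopME /= linearZ. Qed.

Section Constants.
Variable X : topologicalType.

Lemma cst_Cb T : (fun=> T) \in @Cb_strong_star R H X.
Proof.
by apply/asboolP; split; [exists (opnorm T)|exact: strong_cont_cst|
  exact: strong_cont_cst].
Qed.

Definition cst_multiplier T : multiplier H X := Multiplier (cst_Cb T).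

Lemma cst_multiplierM S T :
  cst_multiplier (S * T) = cst_multiplier S * cst_multiplier T.
Proof. exact: multiplier_eq. Qed.

Lemma cst_multiplierD S T :
  cst_multiplier (S + T) = cst_multiplier S + cst_multiplier T.
Proof. exact: multiplier_eq. Qed.

Lemma cst_multiplier1 : cst_multiplier 1 = 1.
Proof. exact: multiplier_eq. Qed.

Lemma cst_multiplier_star T : cst_multiplier (star T) = star (cst_multiplier T).
Proof. exact: multiplier_eq. Qed.

End Constants.

End Operators.

(** * Swindle sums and inverses in M(I) *)

Section Multipliers.
Variables (R : realType) (H : hilbertType R) (X : topologicalType).
Local Notation M := (multiplier H X).

Lemma multiplierME (a b : M) x v : (a * b) x v = a x (b x v).
Proof. by []. Qed.
Lemma multiplierDE (a b : M) x v : (a + b) x v = a x v + b x v.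
Proof. by []. Qed.
Lemma multiplierBE (a b : M) x v : (a - b) x v = a x v - b x v.
Proof. by []. Qed.
Lemma multiplierXE (a : M) n x : (a ^+ n) x = a x ^+ n.
Proof. by elim: n => // n IH; rewrite !exprS -IH. Qed.
Lemma multiplier_starE (a : M) x : (star a) x = star (a x).
Proof. by []. Qed.

Section Swindle.
Variables s t : bop H.
Hypotheses (s_iso : star s * s = 1) (t_iso : star t * t = 1).
Hypothesis st0 : star s * t = 0.
Hypothesis t_pure : forall v (e : R), 0 < e ->
  exists n, vnorm ((star t ^+ n) v) < e.

(** The terms after the first [N] form a conjugate by [T ^+ N], so at [v] they are bounded by the
    norm of [(star t ^+ N) v], whatever the point of [X]. Purity of [t] thus makes the partial sums
    Cauchy uniformly on [X]. *)
Lemma multiplier_swindle (x : M) : star x = x -> x * x = x ->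
  exists y : M, [/\ star y = y, y * y = y &
    y = cst_multiplier X s * x * star (cst_multiplier X s)
        + cst_multiplier X t * y * star (cst_multiplier X t)].
Proof.
move=> xs xx; set S := cst_multiplier X s; set T := cst_multiplier X t.
have SS : star S * S = 1.
  by rewrite -cst_multiplier_star -cst_multiplierM s_iso cst_multiplier1.
have TT : star T * T = 1.
  by rewrite -cst_multiplier_star -cst_multiplierM t_iso cst_multiplier1.
have ST : star S * T = 0.
  rewrite -cst_multiplier_star -cst_multiplierM st0.
  exact: multiplier_eq.
have TS : star T * S = 0 by rewrite -[LHS]starK starM starK ST star0.
(* y n = \sum_(i < n) t^i s x s^* t^*i, with pairwise orthogonal summands *)
pose c := S * x * star S; pose y n := iter n (fun z => c + T * z * star T) 0.
have yP n : star (y n) = y n /\ y n * y n = y n.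
  elim: n => [|n [IHs IHm]]; first by rewrite /y /= star0 mul0r.
  rewrite /y iterS -/(y n) starD /c !starM !starK xs IHs !mulrA; split=> //.
  rewrite mulrDr !mulrDl !mulrA.
  rewrite -!(mulrA _ (star _) S) -!(mulrA _ (star _) T) SS TT ST TS.
  rewrite !(mulr0, mul0r, mulr1, addr0, add0r).
  by rewrite -(mulrA S) xx -(mulrA T) IHm.
have yb n z v : vnorm (y n z v) <= 1 * vnorm v.
  have [ys yy] := yP n; rewrite mul1r; apply: proj_vnorm.
    by rewrite -multiplier_starE ys.
  by rewrite -[in RHS]yy.
have ycauchy v (e : R) : 0 < e -> exists N, forall m n, (N <= m)%N -> (N <= n)%N ->
    forall z, vnorm (y m z v - y n z v) < e.
  move=> e0; have e2 : 0 < e / 2 by rewrite divr_gt0.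
  have [N hN] := t_pure v e2; exists N => m n Nm Nn z.
  have key k : (N <= k)%N -> vnorm (y k z v - y N z v) < e / 2.
    move=> /subnKC <-; rewrite /y iter_affine -/(y _) -/(y _) multiplierDE.
    rewrite addrAC subrr add0r !multiplierME !multiplierXE.
    rewrite isometry_vnorm ?(le_lt_trans (yb _ _ _))// ?mul1r//.
    exact: isometry_exp.
  have := vnormD (y m z v - y N z v) (y N z v - y n z v).
  rewrite subrKA (vnormB (y N z v)); have := key _ Nm; have := key _ Nn; lra.
have [l ls ly] := multiplier_lim (fun n => (yP n).1) yb ycauchy.
exists l; split=> //; apply: multiplier_eq => z; apply: bopP => v.
  (* Each [y n] is an idempotent contraction, so [y n v = y n (y n v)] tends to [l (l v)]. *)
  apply: vlim_unique (ly z v); apply/vseqP => e e0.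
  have e2 : 0 < e / 2 by rewrite divr_gt0.
  have /vseqP/(_ _ e2)[N hN] := ly z v.
  have /vseqP/(_ _ e2)[N' hN'] := ly z (l z v).
  exists (maxn N N') => n; rewrite geq_max => /andP[/hN h /hN' h'].
  have -> : y n z v = y n z (y n z v) by rewrite -multiplierME (yP n).2.
  rewrite multiplierME.
  have := vnormD (l z (l z v) - y n z (l z v)) (y n z (l z v) - y n z (y n z v)).
  have := yb n z (l z v - y n z v); rewrite linearB subrKA; lra.
apply: (vlim_unique (ly z v)); rewrite -cvg_shiftS.
rewrite (_ : (fun n => _) = (fun n => c z v + T z (y n z (star T z v))))//.
apply: cvgD; first exact: cvg_cst.
exact/vlim_bop/ly.
Qed.

End Swindle.

Section Inverse.
Variables (b : M) (d : R).
Hypotheses (b_star : star b = b) (d_gt0 : 0 < d).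
Hypothesis b_coercive : forall x v,
  d * vnorm v ^+ 2 <= complex.Re (hdot (b x v) v).

(* Coercivity makes [D = 1 - g b] a strict contraction for a small scalar [g], and
   the inverse is the Neumann series [g (1 + D + D^2 + ...)]. *)
Lemma multiplier_inverse : exists2 c : M, star c = c & b * c = 1.
Proof.
have /asboolP[[C0 hC0] _ _] := multiplierP b.
(* Adding [d] makes [C] positive and ensures [r <= 1] below. *)
pose C := `|C0| + d; have Cd : d <= C by rewrite lerDr.
have C_gt0 : 0 < C by exact: lt_le_trans Cd.
have bC x v : vnorm (b x v) <= C * vnorm v.
  rewrite (le_trans (opnorm_ub _ _))// ler_wpM2r ?vnorm_ge0//.
  by rewrite (le_trans (hC0 x))// (le_trans (ler_norm _))// lerDl ltW.
(* The scalar [d / C ^+ 2] minimises over [g] the bound [1 - 2 g d + g ^+ 2 C ^+ 2] on the squared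
   norm of [D]; the minimum [1 - (d / C) ^+ 2] is [q ^+ 2]. *)
pose g := cst_multiplier X (scale_bop H (d / C ^+ 2)).
have gb (a : M) : g * a = a * g by apply: multiplier_eq => x; exact: scale_bopC.
have gs : star g = g by rewrite -cst_multiplier_star scale_bop_star.
have [D DE] : exists D, D = 1 - g * b by exists (1 - g * b).
have Ds : star D = D by rewrite DE starB star1 starM gs b_star -gb.
pose r := d / C; have r1 : r <= 1 by rewrite ler_pdivrMr// mul1r.
have r0 : 0 < r by rewrite divr_gt0.
pose q := Num.sqrt (1 - r ^+ 2).
have q2 : q ^+ 2 = 1 - r ^+ 2 by rewrite sqr_sqrtr// subr_ge0 expr_le1// ltW.
have q0 : 0 <= q by exact: sqrtr_ge0.
have q1 : q < 1 by have := exprn_gt0 2 r0; nra.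
have Dq x v : vnorm (D x v) <= q * vnorm v.
  rewrite -(@ler_pXn2r _ 2)// ?nnegrE ?mulr_ge0 ?vnorm_ge0//.
  have -> : D x v = v - (d / C ^+ 2)%:C *: b x v by rewrite DE.
  have k0 : 0 <= d / C ^+ 2 by rewrite divr_ge0 ?exprn_ge0 ?ltW.
  rewrite vnormD2 vnormN vnormZ// hdotNr hdotZr conjc_real hdotC.
  have h1 := b_coercive x v.
  have h2 : vnorm (b x v) ^+ 2 <= C ^+ 2 * vnorm v ^+ 2.
    by rewrite -exprMn ler_pXn2r// ?nnegrE ?mulr_ge0 ?vnorm_ge0 ?(ltW C_gt0).
  have -> : complex.Re (- ((d / C ^+ 2)%:C * conjc (hdot (b x v) v))) =
      - (d / C ^+ 2 * complex.Re (hdot (b x v) v)).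
    by case: (hdot _ _) => ? ? /=; rewrite mul0r subr0.
  rewrite !exprMn q2 /r.
  have h3 := ler_wpM2l k0 h1; have h4 := ler_wpM2l (sqr_ge0 (d / C ^+ 2)) h2.
  have -> : (1 - (d / C) ^+ 2) * vnorm v ^+ 2 = vnorm v ^+ 2 +
     (d / C ^+ 2) ^+ 2 * (C ^+ 2 * vnorm v ^+ 2)
     - 2 * (d / C ^+ 2 * (d * vnorm v ^+ 2)).
    by field; rewrite gt_eqF.
  by rewrite -exprMn; move: h3 h4; rewrite !exprMn; lra.
(* Partial sums of the Neumann series, with a factor 1 on the right to fit [iter_affine]. *)
pose y n := iter n (fun z => 1 + D * z * 1) (0 : M).
have yS n : y n.+1 = 1 + D * y n by rewrite /y iterS mulr1.
have ys n : star (y n) = y n.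
  elim: n => [|n IH]; first by rewrite /y /= star0.
  have Dy : D * y n = y n * D.
    elim: n {IH} => [|n IH]; first by rewrite mulr0 mul0r.
    by rewrite !yS mulrDl mulrDr mul1r mulr1 IH mulrA IH.
  by rewrite yS starD star1 starM IH Ds Dy.
(* The sum of the geometric series, i.e. the solution of [B = 1 + q * B]. *)
pose B := (1 - q)^-1; have B0 : 0 < B by rewrite invr_gt0 subr_gt0.
have yB n x v : vnorm (y n x v) <= B * vnorm v.
  elim: n v => [|n IH] v.
    by rewrite /y /= vnorm0 mulr_ge0 ?vnorm_ge0 ?ltW.
  rewrite yS multiplierDE multiplierME.
  rewrite (le_trans (vnormD _ _))//.
  have -> : B * vnorm v = vnorm v + q * (B * vnorm v).
    by rewrite /B; field; rewrite gt_eqF// subr_gt0.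
  by rewrite lerD2l (le_trans (Dq _ _))// ler_wpM2l.
have Dn n x v : vnorm ((D ^+ n) x v) <= q ^+ n * vnorm v.
  elim: n => [|n IH]; first by rewrite !expr0 mul1r.
  by rewrite !exprS multiplierME (le_trans (Dq _ _))// -mulrA ler_wpM2l.
have ycauchy v (e : R) : 0 < e -> exists N, forall m n, (N <= m)%N -> (N <= n)%N ->
    forall z, vnorm (y m z v - y n z v) < e.
  move=> e0; pose K := B * vnorm v + 1.
  have K0 : 0 < K by rewrite ltr_wpDl// mulr_ge0 ?vnorm_ge0 ?ltW.
  have [N hN] : exists N, q ^+ N < e / 2 / K.
    have : q ^+ n @[n --> \oo] --> (0 : R) by apply: cvg_expr; rewrite ger0_norm.
    move=> /cvgrPdist_lt/(_ (e / 2 / K)) []; first by rewrite !divr_gt0.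
    move=> N _ /(_ N (leqnn N)) /=; rewrite sub0r normrN ger0_norm ?exprn_ge0//.
    by exists N.
  exists N => m n Nm Nn z.
  have key k : (N <= k)%N -> vnorm (y k z v - y N z v) < e / 2.
    move=> /subnKC <-; rewrite /y iter_affine -/(y _) -/(y _) multiplierDE.
    rewrite addrAC subrr add0r expr1n mulr1 multiplierME.
    rewrite (le_lt_trans (Dn _ _ _))//; move: hN; rewrite ltr_pdivlMr//.
    apply: le_lt_trans; rewrite ler_wpM2l ?exprn_ge0//.
    by rewrite (le_trans (yB _ _ _))// lerDl.
  have := vnormD (y m z v - y N z v) (y N z v - y n z v).
  rewrite subrKA (vnormB (y N z v)); have := key _ Nm; have := key _ Nn; lra.
have [l ls ly] := multiplier_lim ys yB ycauchy.
have lE : l = 1 + D * l.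
  apply: multiplier_eq => z; apply: bopP => v.
  apply: (vlim_unique (ly z v)); rewrite -cvg_shiftS.
  rewrite (_ : (fun n => _) = (fun n => v + D z (y n z v))); last first.
    by apply/funext => n; rewrite yS.
  apply: cvgD; first exact: cvg_cst.
  exact/vlim_bop/ly.
(* As [D = 1 - g * b], the equation [l = 1 + D * l] reads [g * b * l = 1], and [g] commutes with
   every multiplier. *)
exists (g * l); first by rewrite starM gs ls gb.
rewrite mulrA -gb; move: lE; rewrite DE mulrBl mul1r addrA.
move=> /(congr1 (fun z => z + g * b * l - l)).
by rewrite /= subrK addrK addrAC subrr add0r.
Qed.

End Inverse.
End Multipliers.

(** * Orthonormal bases *)

Section Orthonormal.
Variables (R : realType) (H : hilbertType R).
Implicit Types (u v w : H).

Lemma hdot_suml (I : Type) (r : seq I) (F : I -> H) w :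
  hdot (\sum_(i <- r) F i) w = \sum_(i <- r) hdot (F i) w.
Proof.
elim: r => [|i r IH]; first by rewrite !big_nil (linear0l hdot).
by rewrite !big_cons hdotDl IH.
Qed.

Lemma hdot_sumr (I : Type) (r : seq I) (F : I -> H) w :
  hdot w (\sum_(i <- r) F i) = \sum_(i <- r) hdot w (F i).
Proof.
elim: r => [|i r IH]; first by rewrite !big_nil (linear0r hdot).
by rewrite !big_cons hdotDr IH.
Qed.

(** Only the first [n] terms are constrained, so a sequence still under construction qualifies. *)
Definition orthonormal_upto (e : nat -> H) n :=
  forall i j, (i < n)%N -> (j < n)%N -> hdot (e i) (e j) = (i == j)%:R.

Definition expansion (e : nat -> H) n v := \sum_(0 <= i < n) hdot v (e i) *: e i.

Lemma hdot_expansion (e : nat -> H) n v i : orthonormal_upto e n -> (i < n)%N ->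
  hdot (expansion e n v) (e i) = hdot v (e i).
Proof.
move=> he ni; rewrite /expansion hdot_suml (bigD1_seq i)/= ?mem_index_iota ?iota_uniq//.
rewrite hdotZl he// eqxx mulr1 big_seq_cond big1 ?addr0// => j.
rewrite mem_index_iota /= => /andP[nj ij].
by rewrite hdotZl he// (negbTE ij) mulr0.
Qed.

Lemma expansionB (e : nat -> H) n u v :
  expansion e n (u - v) = expansion e n u - expansion e n v.
Proof.
rewrite /expansion -sumrB; apply: eq_bigr => i _.
by rewrite hdotDl hdotNl scalerBl.
Qed.

(** The remainder is orthogonal to the expansion. The identity bounds both of them by [v]. *)
Lemma pythagoras (e : nat -> H) n v : orthonormal_upto e n ->
  vnorm v ^+ 2 = vnorm (v - expansion e n v) ^+ 2 + vnorm (expansion e n v) ^+ 2.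
Proof.
move=> he; have := vnormD2 (v - expansion e n v) (expansion e n v).
rewrite subrK => ->; suff -> : hdot (v - expansion e n v) (expansion e n v) = 0.
  by rewrite /= mulr0 addr0.
rewrite {2}/expansion hdot_sumr big_seq big1// => i; rewrite mem_index_iota => /= ni.
by rewrite hdotZr hdotDl hdotNl hdot_expansion ?subrr ?mulr0.
Qed.

(* If [d] already lies in the span of the [e i], then [u] is an arbitrary unit
   vector orthogonal to them, which exists in infinite dimension. *)
Lemma gram_schmidt_step (e : nat -> H) n d : ~ finite_dimensional H ->
  orthonormal_upto e n -> exists u, [/\ hdot u u = 1,
    forall i, (i < n)%N -> hdot u (e i) = 0 &
    d = expansion e n d + hdot d u *: u].
Proof.
move=> Hinf he; pose res v := v - expansion e n v.
have res_orth v i : (i < n)%N -> hdot (res v) (e i) = 0.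
  by move=> ni; rewrite /res hdotDl hdotNl hdot_expansion// subrr.
have [x x0 hx] : exists2 x, res x != 0 & x = d \/ res d = 0.
  have [d0|d0] := eqVneq (res d) 0; last by exists d => //; left.
  have [[x x0]|/forallNP h] := pselect (exists x, res x != 0).
    by exists x => //; right.
  exfalso; apply: Hinf; exists n, (fun i => e i) => v.
  exists (fun i => hdot v (e i)); apply/eqP; rewrite -subr_eq0.
  by have /negP := h v; rewrite negbK /res /expansion big_mkord.
pose c := vnorm (res x).
have c0 : c != 0 by apply: contra_neq x0 => /vnorm_eq0.
exists (c^-1%:C *: res x); split.
- rewrite hdotZl hdotZr conjc_real hdot_vnorm -/c -!rmorphM /= expr2 mulKf// mulVf//.
- by move=> i ni; rewrite hdotZl res_orth// mulr0.
have dE : d = expansion e n d + res d by rewrite /res subrKC.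
rewrite {1}dE; congr (_ + _).
have orth w : hdot (expansion e n w) (res x) = 0.
  rewrite /expansion hdot_suml big_seq big1// => i; rewrite mem_index_iota => /= ni.
  by rewrite hdotZl (hdotC (e i)) res_orth// conjc0 mulr0.
rewrite dE hdotDl !hdotZr orth mulr0 add0r conjc_real -dE.
(* Either [x = d] and the normalising factors cancel, or [res d = 0] and both sides vanish. *)
case: hx => [<-|->]; last by rewrite (linear0l hdot) mulr0 scale0r.
rewrite hdot_vnorm -/c scalerA -!rmorphM /= expr2 mulKf// divff// scale1r//.
Qed.

(** Every step adds a unit vector, even when [d n] is already spanned, so the orthonormal sequence
    never stops. *)
Lemma gram_schmidt (d : nat -> H) : ~ finite_dimensional H ->
  exists e : nat -> H, (forall i j, hdot (e i) (e j) = (i == j)%:R) /\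
    forall n, d n = expansion e n.+1 (d n).
Proof.
move=> Hinf.
pose P (s : seq H) x u := [/\ hdot u u = 1,
    forall i, (i < size s)%N -> hdot u (nth 0 s i) = 0 &
    x = expansion (nth 0 s) (size s) x + hdot x u *: u].
(* The choice satisfies [P] only once the vectors in [s] are known to be orthonormal, hence the
   induction in [eP]; 0 is a dummy default. *)
pose next s x := xget 0 (P s x).
pose E := fix E n := if n is k.+1 then rcons (E k) (next (E k) (d k)) else [::].
pose e n := next (E n) (d n).
have ES n : E n.+1 = rcons (E n) (e n) by [].
have sE n : size (E n) = n by elim: n => // n IH; rewrite ES size_rcons IH.
have nE n i : (i < n)%N -> nth 0 (E n) i = e i.
  elim: n => // n IH; rewrite ltnS leq_eqVlt ES nth_rcons sE => /orP[/eqP->|ni].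
    by rewrite ltnn eqxx.
  by rewrite ni IH.
have main n : orthonormal_upto e n -> P (E n) (d n) (e n).
  move=> he; apply: (@xgetPex _ 0 (P (E n) (d n))).
  apply: gram_schmidt_step => //; rewrite sE => i j ni nj.
  by rewrite !nE// he.
have eP n : orthonormal_upto e n.
  elim: n => // n IH i j; rewrite !ltnS.
  have [e1 e2 _] := main n IH; rewrite sE in e2.
  have e3 k : (k < n)%N -> hdot (e n) (e k) = 0.
    by move=> kn; rewrite -(nE n k kn); exact: e2.
  rewrite leq_eqVlt => /orP[/eqP->|ni]; rewrite leq_eqVlt => /orP[/eqP->|nj].
  - by rewrite eqxx e1.
  - by rewrite e3// gtn_eqF.
  - by rewrite hdotC e3// conjc0 ltn_eqF.
  - exact: IH.
exists e; split=> [i j|n].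
  by apply: (eP (maxn i j).+1); rewrite ltnS ?leq_maxl ?leq_maxr.
have [_ _ {1}->] := main n (eP n).
rewrite /expansion [in RHS]big_nat_recr//= sE; congr (_ + _).
by apply: eq_big_nat => i /= ni; rewrite nE.
Qed.

(** A truncation of the operator taking [e i] to [f i]; for [f = e] it is a block of the expansion
    of [v]. *)
Definition transfer (e f : nat -> H) m n v := \sum_(m <= i < n) hdot v (e i) *: f i.

Lemma vnorm_transfer (e f : nat -> H) m n v :
  (forall i j, hdot (f i) (f j) = (i == j)%:R) ->
  vnorm (transfer e f m n v) ^+ 2 = \sum_(m <= i < n) vnorm (hdot v (e i) *: f i) ^+ 2.
Proof.
move=> hf; apply: complexI; rewrite -hdot_vnorm rmorph_sum /=.
rewrite /transfer hdot_suml; apply: eq_big_seq => i ri.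
rewrite hdot_sumr (bigD1_seq i)/= ?iota_uniq// big1 ?addr0 ?hdot_vnorm//.
by move=> j ij; rewrite hdotZl hdotZr hf eq_sym (negbTE ij) !mulr0.
Qed.

Section Basis.
Variable e : nat -> H.
Hypothesis e_orth : forall i j, hdot (e i) (e j) = (i == j)%:R.
Hypothesis e_total : forall v, expansion e n v @[n --> \oo] --> v.

Lemma basis_ext u v : (forall i, hdot u (e i) = hdot v (e i)) -> u = v.
Proof.
move=> h; apply: (vlim_unique (@e_total u)).
rewrite (_ : expansion e ^~ u = expansion e ^~ v); first exact: e_total.
by apply/funext => n; rewrite /expansion; apply: eq_bigr => i _; rewrite h.
Qed.

Lemma bop_expansion (T : bop H) n v :
  T (expansion e n v) = \sum_(0 <= i < n) hdot v (e i) *: T (e i).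
Proof. by rewrite /expansion linear_sum; apply: eq_bigr => i _; rewrite linearZ. Qed.

Lemma bop_basis_ext (S T : bop H) : (forall i, S (e i) = T (e i)) -> S = T.
Proof.
move=> h; apply: bopP => v; apply: (vlim_unique (vlim_bop (T := S) (@e_total v))).
rewrite (_ : (fun n => _) = fun n => T (expansion e n v)).
  exact/vlim_bop/e_total.
by apply/funext => n; rewrite !bop_expansion; apply: eq_bigr => i _; rewrite h.
Qed.

(** The norm of a transfer depends only on the coefficients, so [f] may be replaced by [e]; the
    truncations then converge strongly because the expansions in [e] do. *)
Lemma basis_isometry (f : nat -> H) : (forall i j, hdot (f i) (f j) = (i == j)%:R) ->
  exists T : bop H, [/\ forall i, T (e i) = f i, star T * T = 1 &
    forall v, (forall i, hdot (f i) v = 0) -> star T v = 0].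
Proof.
move=> hf.
have norm_ef m n v : vnorm (transfer e f m n v) = vnorm (transfer e e m n v).
  apply/eqP; rewrite -(@eqrXn2 _ 2)// ?vnorm_ge0// !vnorm_transfer//.
  apply/eqP/eq_bigr => i _; apply: complexI; rewrite -!hdot_vnorm.
  by rewrite !hdotZl !hdotZr hf e_orth.
have tB (g : nat -> H) m n v : (m <= n)%N ->
    transfer e g 0 n v - transfer e g 0 m v = transfer e g m n v.
  by move=> mn; rewrite /transfer (big_cat_nat (n := m))//= addrAC subrr add0r.
have Tl n : linear (transfer e f 0 n).
  move=> a u v; rewrite /transfer scaler_sumr -big_split; apply: eq_bigr => i _.
  by rewrite hdotDl hdotZl scalerDl scalerA.
have exp_le n v : vnorm (transfer e f 0 n v) <= 1 * vnorm v.
  rewrite mul1r norm_ef -[transfer e e 0 n v]/(expansion e n v).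
  rewrite -(@ler_pXn2r _ 2)// ?nnegrE ?vnorm_ge0//.
  rewrite (@pythagoras e n v) ?lerDr ?sqr_ge0// => i j _ _; exact: e_orth.
pose T n := Bop (Tl n) (ex_intro _ 1 (exp_le n)).
have [|v r r0|V hV _] := @bop_strong_lim R H T 1.
- exact: exp_le.
- have r2 : 0 < r / 2 by rewrite divr_gt0.
  have /vseqP/(_ _ r2)[N hN] := @e_total v; exists N.
  have key m n : (N <= m)%N -> (N <= n)%N -> (m <= n)%N -> vnorm (T m v - T n v) < r.
    move=> Nm Nn mn; rewrite vnormB /= tB// norm_ef -tB//.
    rewrite -[transfer e e 0 n v]/(expansion e n v).
    rewrite -[transfer e e 0 m v]/(expansion e m v).
    have := hN _ Nm; have := hN _ Nn; rewrite (vnormB v (expansion e n v)).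
    have := vnormD (expansion e n v - v) (v - expansion e m v).
    by rewrite subrKA; lra.
  move=> m n Nm Nn; have [mn|/ltnW mn] := leqP m n; first exact: key.
  by rewrite vnormB key.
have Ve k : V (e k) = f k.
  apply: (vlim_unique (hV (e k))); apply/vseqP => r r0; exists k.+1 => n kn.
  rewrite /= /transfer (bigD1_seq k)/= ?mem_index_iota ?iota_uniq//.
  rewrite e_orth eqxx scale1r big1 ?addr0 ?subrr ?vnorm0// => j jk.
  by rewrite e_orth eq_sym (negbTE jk) scale0r.
exists V; split=> // [|v hv].
  apply: bop_basis_ext => i; apply: basis_ext => j.
  by rewrite bopME bop_starE !Ve hf e_orth.
apply: basis_ext => j; rewrite bop_starE Ve hdotC hv conjc0.
by rewrite (linear0l hdot).
Qed.

End Basis.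

(** Apply Gram-Schmidt to a dense sequence. A nearby [w] of that sequence equals its own finite
    expansion, so the remainder of [v] is that of [v - w], which is no longer than [v - w]. *)
Lemma orthonormal_basis : separable H -> ~ finite_dimensional H ->
  exists e : nat -> H, (forall i j, hdot (e i) (e j) = (i == j)%:R) /\
    forall v, expansion e n v @[n --> \oo] --> v.
Proof.
move=> [D cD dD] Hinf.
have [d dE] : exists d : nat -> H, D `<=` range d.
  have [f fi] := countable_injP _ cD.
  exists (fun n => xget 0 (D `&` f @^-1` [set n])) => x Dx; exists (f x) => //.
  have [|Dy fy] := @xgetPex _ 0 (D `&` f @^-1` [set f x]); first by exists x.
  by apply: fi => //; rewrite inE.
have [e [eo de]] := gram_schmidt d Hinf.
exists e; split=> // v; apply/vseqP => r r0.
have r2 : 0 < r / 2 by rewrite divr_gt0.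
have r20 : 0 < (r / 2)%:C :> R[i] by rewrite ltcR.
have [||w []] := dD (ball v (r / 2)%:C).
- by exists v; exact: ballxx.
- exact: ball_open.
rewrite -ball_normE /ball_/= vnormE ltcR => vw /dE[k _ kw].
exists k.+1 => n kn.
have eu j : orthonormal_upto e j by move=> *; exact: eo.
have we : w = expansion e n w.
  have w0 i : (k < i)%N -> hdot w (e i) = 0.
    move=> ki; rewrite -kw de /expansion hdot_suml big_seq big1// => j.
    rewrite mem_index_iota => /= jk; rewrite hdotZl eo ltn_eqF ?mulr0//.
    exact: leq_trans ki.
  rewrite {1}(_ : w = expansion e k.+1 w); last by rewrite -kw.
  rewrite /expansion [RHS](big_cat_nat (n := k.+1))//= [X in _ = _ + X]big_nat.
  by rewrite [X in _ = _ + X]big1 ?addr0// => i /andP[ki _]; rewrite w0 ?scale0r.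
have -> : v - expansion e n v = (v - w) - expansion e n (v - w).
  by rewrite expansionB -we opprB subrKA.
rewrite (@le_lt_trans _ _ (vnorm (v - w)))//; last by lra.
rewrite -(@ler_pXn2r _ 2)// ?nnegrE ?vnorm_ge0//.
by rewrite (@pythagoras e n (v - w)) ?lerDl ?sqr_ge0.
Qed.
End Orthonormal.

(** * Lifting projections *)

Section Lifting.
Variables (A B : starRingType) (f : starMorphism A B) (g : B -> A).
Hypothesis gK : cancel g f.
Hypothesis inverse : forall a : A, star a = a ->
  exists2 c : A, star c = c & (1 - a + a * a) * c = 1.

(** [mxstar T *m T = a] need not be invertible; the extra entry [1 - a], which vanishes in [B],
    turns it into [a + (1 - a) ^+ 2 = 1 - a + a * a], invertible by [inverse]. *)
Lemma proj_liftable_mvn1 m n (p : 'M[B]_m) : (0 < n)%N ->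
  mvn (block_mx p 0 0 (1%:M : 'M[B]_n)) (1%:M : 'M[B]_1) ->
  proj_liftable f (block_mx p 0 0 (block_mx 1%:M 0 0 0 : 'M[B]_(n + n))).
Proof.
move=> n_gt0 [v [vv v1]]; pose T := map_mx g (mxstar v).
have fT : map_mx f T = mxstar v by apply/matrixP => i j; rewrite !mxE gK.
have mx11 (C : starRingType) (z : 'M[C]_1) : z = (z 0 0)%:M.
  by apply/matrixP => i j; rewrite !ord1 mxE eqxx mulr1n.
have star_scalar (C : starRingType) (z : C) : mxstar (z%:M : 'M[C]_1) = (star z)%:M.
  by apply/matrixP => i j; rewrite !ord1 !mxE eqxx !mulr1n.
have [a aE] : exists a, mxstar T *m T = a%:M by eexists; exact: mx11.
have scalarI (C : starRingType) (x y : C) : x%:M = y%:M :> 'M[C]_1 -> x = y.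
  by move=> /(congr1 (fun z : 'M[C]_1 => z 0 0)); rewrite !mxE eqxx !mulr1n.
have as_ : star a = a by apply: scalarI; rewrite -star_scalar -aE mxstarM mxstarK.
have fa : f a = 1.
  apply: scalarI; rewrite -map_scalar_mx -aE map_mxM -mxstar_map fT mxstarK.
  by rewrite v1.
have [c cs bc] := inverse as_.
have fc : f c = 1.
  have := congr1 f bc.
  by rewrite rmorphM rmorphD rmorphB rmorphM rmorph1 /= fa subrr add0r !mul1r rmorph1.
(* The entry [1 - a] occupies the first coordinate of the zero block, which exists because
   [0 < n]. *)
pose k : 'M[A]_(n, 1) := delta_mx (Ordinal n_gt0) 0 *m (1 - a)%:M.
have kk : mxstar k *m k = ((1 - a) * (1 - a))%:M.
  have dd : mxstar (delta_mx (Ordinal n_gt0) 0 : 'M[A]_(n, 1)) *m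
      delta_mx (Ordinal n_gt0) 0 = 1%:M.
    apply/matrixP => i j; rewrite !ord1 !mxE (bigD1 (Ordinal n_gt0))//= big1.
      by rewrite !mxE !eqxx mulr1 star1 addr0.
    by move=> l ln; rewrite !mxE (negbTE ln) mulr0.
  rewrite mxstarM star_scalar starB star1 as_ -mulmxA (mulmxA _ (delta_mx _ _)) dd.
  by rewrite mul1mx -scalar_mxM.
have fk : map_mx f k = 0.
  by rewrite map_mxM map_scalar_mx rmorphB rmorph1 /= fa subrr raddf0 mulmx0.
pose W := col_mx (usubmx T) (col_mx (dsubmx T) k).
have WW : mxstar W *m W = (1 - a + a * a)%:M.
  rewrite !mxstar_col !mul_row_col kk addrA -mul_row_col -mxstar_col vsubmxK aE.
  rewrite -raddfD /= mulrBr mulr1 mulrBl mul1r; congr (_%:M).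
  by rewrite opprB addrCA [a + _]addrC subrK.
have fW : map_mx f W = col_mx (usubmx (mxstar v)) (col_mx (dsubmx (mxstar v)) 0).
  by rewrite !map_col_mx map_usubmx map_dsubmx fT fk.
(* Idempotent because [c] inverts [mxstar W *m W]; since [f c = 1], its image is [map_mx f W] times
   the adjoint. *)
exists (W *m c%:M *m mxstar W).
  split; first by rewrite !mxstarM mxstarK star_scalar cs mulmxA.
  rewrite -!mulmxA (mulmxA _ W) WW (mulmxA (_ + _)%:M) -scalar_mxM bc.
  by rewrite mul1mx.
rewrite !map_mxM -mxstar_map map_scalar_mx /= fc mulmx1 fW.
have [x [y vE]] : exists x y, mxstar v = col_mx x y.
  by exists (usubmx (mxstar v)), (dsubmx (mxstar v)); rewrite vsubmxK.
have vE' : v = row_mx (mxstar x) (mxstar y) by rewrite -mxstar_col -vE mxstarK.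
move: vv; rewrite vE vE' mul_col_row => /eq_block_mx[xx xy yx yy].
rewrite col_mxKu col_mxKd.
rewrite !mxstar_col mul_col_row mul_mx_row mul_col_mx mul_col_row.
by rewrite xx xy yx yy mxstar0 !mul0mx !mulmx0 row_mx0 col_mx0.
Qed.

End Lifting.

(** If [q] is the lift, then [[p] = [f(q)] - [1_n]], and [[1_n]] comes from [A]. *)
Lemma K0_liftable_of_proj (A B : starRingType) (f : starMorphism A B) m n k
    (p : 'M[B]_m) (hp : is_proj p) :
  proj_liftable f (block_mx p 0 0 (block_mx (1%:M : 'M[B]_n) 0 0 (0 : 'M[B]_k))) ->
  K0_liftable f (K0_class hp).
Proof.
move=> [q hq fq]; exists (groth_sub (V0_class hq) (V0_class (is_proj1 A n))).
have -> x y : K0_map f (groth_sub x y) = groth_sub (V0_map f x) (V0_map f y).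
  exact: groth_mapE.
apply/groth_subP; exists 0; rewrite !addr0 V0_map1 V0_mapE.
rewrite -[V0_class (is_proj1 B n)]addr0 -(V0_0 B k).
rewrite (V0_addDE (is_proj1 B n) (is_proj0 B k)) V0_addDE.
by apply/V0_classP; rewrite -fq; exact/mvn_refl/is_proj_map.
Qed.

(** * Two isometries of H with complementary ranges *)

Section Shifts.
Variables (R : realType) (H : hilbertType R).

(** On a basis, [s] sends [e i] to [e i.*2] and [t] sends it to [e i.*2.+1]. Since [s] fixes [e 0],
    only [t] can be pure. *)
Lemma shift_isometries : separable H -> ~ finite_dimensional H ->
  exists s t : bop H, [/\ star s * s = 1, star t * t = 1,
    s * star s + t * star t = 1 &
    forall v (e : R), 0 < e -> exists n, vnorm ((star t ^+ n) v) < e].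
Proof.
move=> Hsep Hinf; have [e [eo et]] := orthonormal_basis Hsep Hinf.
have e2o i j : hdot (e i.*2) (e j.*2) = (i == j)%:R.
  by rewrite eo -!muln2 eqn_pmul2r.
have e2So i j : hdot (e i.*2.+1) (e j.*2.+1) = (i == j)%:R.
  by rewrite eo eqSS -!muln2 eqn_pmul2r.
have [s [se ss s0]] := basis_isometry eo et e2o.
have [t [te tt t0]] := basis_isometry eo et e2So.
have neq i j : (i.*2 == j.*2.+1) = false.
  by apply/negP => /eqP/(congr1 odd); rewrite /= !odd_double.
have s0e i : star s (e i.*2.+1) = 0 by apply: s0 => j; rewrite eo neq.
have t0e i : star t (e i.*2) = 0 by apply: t0 => j; rewrite eo eq_sym neq.
have sse i : star s (e i.*2) = e i by rewrite -se -bopME ss.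
have tte i : star t (e i.*2.+1) = e i by rewrite -te -bopME tt.
have double i : (exists j, i = j.*2) \/ (exists j, i = j.*2.+1).
  rewrite -(odd_double_half i); case: (odd i); [right|left]; by exists i./2.
exists s, t; split=> //.
  apply: (bop_basis_ext et) => i; rewrite bopDE !bopME.
  have [[j ->]|[j ->]] := double i.
    by rewrite sse t0e se linear0 addr0.
  by rewrite s0e tte te linear0 add0r.
(* [star t] kills [e j.*2] and sends [e j.*2.+1] to [e j], so every application strictly lowers a
   surviving index. *)
have tn n k : (k < n)%N -> (star t ^+ n) (e k) = 0.
  elim: n k => // n IH k; rewrite ltnS exprSr bopME.
  have [[j ->]|[j ->]] := double k; first by rewrite t0e linear0.
  by rewrite tte => jn; apply: IH; apply: leq_trans jn; rewrite ltnS -addnn leq_addr.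
move=> v r r0; have /vseqP/(_ _ r0)[N hN] := @et v; exists N.
have -> : (star t ^+ N) v = (star t ^+ N) (v - expansion e N v).
  rewrite linearB [X in _ - X]bop_expansion big_seq big1 ?subr0// => i.
  by rewrite mem_index_iota => /= iN; rewrite tn// scaler0.
apply: le_lt_trans (hN N (leqnn N)).
rewrite -star_exp; set T := t ^+ N; have TT : star T * T = 1 by exact: isometry_exp.
(* [star T] is a contraction: composed with the isometry [T] it becomes the projection
   [T * star T]. *)
rewrite -(isometry_vnorm _ TT) -bopME; apply: proj_vnorm.
  by rewrite starM starK.
by rewrite mulrA -(mulrA T) TT mulr1.
Qed.

End Shifts.

(** * Absorption, inverses and lifts for M(I) and its corona *)

Section MultiplierAlgebra.
Variables (R : realType) (H : hilbertType R) (X : topologicalType).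

Lemma V0_multiplier_absorb : separable H -> ~ finite_dimensional H ->
  forall x : V0 (multiplier H X),
  x + V0_class (is_proj1 _ 1) = V0_class (is_proj1 _ 1).
Proof.
move=> Hsep Hinf; have [s [t [ss tt st t_pure]]] := shift_isometries Hsep Hinf.
have cM := @cst_multiplierM R H X; have cS := @cst_multiplier_star R H X.
apply: (@V0_absorb _ (cst_multiplier X s) (cst_multiplier X t)).
- by rewrite -cS -cM ss cst_multiplier1.
- by rewrite -cS -cM tt cst_multiplier1.
- by rewrite -!cS -!cM -cst_multiplierD st cst_multiplier1.
move=> x xs xx; apply: multiplier_swindle => //.
exact: isometry_orth st.
Qed.

(** With [r] and [q] the norms of [a x v] and [v] in either order, Cauchy-Schwarz and a completed
    square give [r ^+ 2 - r q + q ^+ 2 >= 3 / 4] times the squared norm of [v]. *)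
Lemma multiplier_quadratic_inverse (a : multiplier H X) : star a = a ->
  exists2 c : multiplier H X, star c = c & (1 - a + a * a) * c = 1.
Proof.
move=> sa; apply: (@multiplier_inverse R H X _ (3 / 4)).
- by rewrite starD starB star1 starM sa.
- by rewrite divr_gt0.
move=> x v; rewrite multiplierDE multiplierBE hdotDl hdotDl hdotNl.
rewrite -[hdot (_ v) v]/(hdot v v).
have -> : hdot ((a * a) x v) v = hdot (a x v) (a x v).
  by rewrite multiplierME -{1}sa multiplier_starE bop_starE.
have := cauchy_schwarz_re (a x v) v; rewrite !hdot_vnorm.
case: (hdot (a x v) v) => y z /=.
have := vnorm_ge0 v; have := vnorm_ge0 (a x v); move: (vnorm _) (vnorm _) => r q.
have := sqr_ge0 (q - r / 2); rewrite !expr2; lra.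
Qed.

Lemma corona_pi_surj (y : corona H X) : exists x, corona_pi H X x = y.
Proof. by exists (repr y); exact: (@reprK _ (corona H X)). Qed.

End MultiplierAlgebra.

Theorem corollary4p8 (R : realType) (H : hilbertType R)
    (H_sep : separable H) (H_inf : ~ finite_dimensional H)
    (k : base_kind) (m n : nat) (m_gt0 : (0 < m)%N) (n_gt0 : (0 < n)%N)
    (p : 'M[corona H (base_space R k)]_m) (p_proj : is_proj p) :
  K0_liftable (corona_pi H (base_space R k)) (K0_class p_proj) <->
  proj_liftable (corona_pi H (base_space R k))
    (block_mx p 0 0 (block_mx 1%:M 0 0 0 : 'M[corona H (base_space R k)]_(n + n))).
Proof.
split; last exact: K0_liftable_of_proj.
have absorb := @V0_multiplier_absorb R H (base_space R k) H_sep H_inf.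
move=> /(K0_liftable_absorb absorb) p1.
have /choice[g gK] := @corona_pi_surj R H (base_space R k).
apply: (proj_liftable_mvn1 gK (@multiplier_quadratic_inverse R H _) n_gt0).
apply/(V0_classP (is_proj_block p_proj (is_proj1 _ n)) (is_proj1 _ 1)).
(* Writing the target [[1]] as [[p] + [1]] leaves only [[1_n] = [1]], which holds as [n] is
   positive. *)
rewrite -V0_addDE -p1; congr (_ + _).
case: n n_gt0 => // n' _; exact: (V0_1S absorb (corona_pi H (base_space R k))).
Qed.
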